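(* Assume that the following hold. (A1) For each $k\ge 1$ there exist $\alpha,\delta_0>0$ and $M\ge 1$ such that, for all $\delta\in(0,\delta_0]$, $\sup\{q(\theta,\alpha):\theta\in S_k(\delta)\}\le M$. (A2) For every $k\ge1$ and $\theta\in\Theta_k$ there exists $\eta_\theta>0$ such that $V(u_{\theta,\eta_\theta},f^\star)+V(f^\star,l_{\theta,\eta_\theta})+V(f^\star,u_{\theta,\eta_\theta})+V(u_{\theta,\eta_\theta},f_\theta)<\infty$. Assume moreover that $\pi(k)>0$ and $\pi_k\{S_k(\delta)\}>0$ for all $\delta>0$ and $k=1,\dots,k^\star$. (i) There exist $c_1',c_2'>0$ such that, for every $n\ge1$, $$P^{\star n}\{\widehat k_n^{\mathrm G}<k^\star\}\le c_1'e^{-nc_2'}.$$ (ii) If, in addition, $H_k^\star>H_{k+1}^\star$ for $k=1,\dots,k^\star-1$, then there exist $c_1,c_2>0$ such that, for every $n\ge1$, $$P^{\star n}\{\widehat k_n^{\mathrm L}<k^\star\}\le c_1e^{-nc_2}.$$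
   Context: Model. $Z_1,\dots,Z_n$ are i.i.d. random variables with values in a measured space $(\mathcal Z,\mathcal F,\mu)$; $Z^n=(Z_1,\dots,Z_n)$. $(\Theta_k)_{k\ge1}$ is an increasing family of nested finite-dimensional parameter sets, $d$ is the Euclidean distance on each, $\Theta_\infty=\bigcup_{k\ge1}\Theta_k$, $\Theta_0=\varnothing$. For $\theta\in\Theta_\infty$, $f_\theta$ is the density with respect to $\mu$ of a probability measure $P_\theta$, and $\ell_\theta=\log f_\theta$. The common law of the $Z_i$ is $P^\star=P_{\theta^\star}$, with density $f^\star=f_{\theta^\star}$, $\ell^\star=\log f^\star$, where $\theta^\star\in\Theta_{k^\star}\setminus\Theta_{k^\star-1}$; the integer $k^\star$ is the order of $P^\star$, i.e. the unique $k$ such that $P^\star\in\{P_\theta:\theta\in\Theta_k\setminus\Theta_{k-1}\}$. $P^{\star n}$ is the $n$-fold product of $P^\star$. Standing assumptions: for every $k\ge1$, $(\Theta_k,d)$ is compact and $\theta\mapsto\ell_\theta(z)$ is continuous from $\Theta_k$ to $\mathbb R$ for every $z\in\mathcal Z$. Prior and estimators. $\Pi$ is a prior on $\Theta_\infty$ of the form $d\Pi(\theta)=\pi(k)\pi_k(\theta)\,d\theta$ for $\theta\in\Theta_k$, $k\ge1$ ($\pi$ is a probability on the orders, $\pi_k$ a probability density on $\Theta_k$; $\pi_k$ also denotes the associated probability measure). $\Pi(k|Z^n)$ is the posterior probability of $k$. The estimators are $\widehat k_n^{\mathrm G}=\arg\max_{k\ge1}\Pi(k|Z^n)$ and $\widehat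 k_n^{\mathrm L}=\inf\{k\ge1:\Pi(k|Z^n)\ge\Pi(k+1|Z^n)\}$. Notation. $\lambda f$ denotes $\int f\,d\lambda$. For nonzero nonnegative $\mu$-integrable $f$, $P_f$ is the measure with derivative $f$ with respect to $\mu$; $V(f,f')=P_f(\log f-\log f')^2$ (possibly $\infty$). $H(\theta)=P^\star(\ell^\star-\ell_\theta)$ is the Kullback–Leibler divergence of $P_\theta$ from $P^\star$ ($\infty$ if $P^\star\not\ll P_\theta$). For $k\ge1$, $\delta>0$, $t\in\Theta_k$: $l_{t,\delta}=\inf\{f_{\theta'}:\theta'\in\Theta_k,d(t,\theta')<\delta\}$, $u_{t,\delta}=\sup\{f_{\theta'}:\theta'\in\Theta_k,d(t,\theta')<\delta\}$ (pointwise), $H_k^\star=\inf\{H(\theta'):\theta'\in\Theta_k\}$, $S_k(\delta)=\{\theta'\in\Theta_k:H(\theta')\le H_k^\star+\delta/2\}$. By definition of $k^\star$, $H_k^\star=0$ for $k\ge k^\star$ and $H_k^\star>0$ otherwise. For $\theta\in\Theta_\infty$, $\alpha>0$: $q(\theta,\alpha)=P^\star\big[(\ell^\star-\ell_\theta)^2e^{\alpha(\ell^\star-\ell_\theta)}\big]+V(f^\star,f_\theta)\in[0,\infty]$. *)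

(* Defs.v *)
From HB Require Import structures.
From mathcomp Require Import all_boot all_order all_algebra.
From mathcomp Require Import all_classical all_reals all_analysis.
Set Implicit Arguments.
Unset Strict Implicit.
Unset Printing Implicit Defensive.
Import Order.TTheory GRing.Theory Num.Theory.
Import numFieldNormedType.Exports.
Local Open Scope classical_set_scope.
Local Open Scope ring_scope.

(* n-fold product of a sigma-finite measure, on n-tuples; it is characterized by
   [power_measure_box] below. *)
Section power_measure.
Context d (T : measurableType d) (R : realType).
Variable m : {sigma_finite_measure set T -> \bar R}.

Definition cons_tuple n (x : T * n.-tuple T) : n.+1.-tuple T :=
  [the n.+1.-tuple T of x.1 :: x.2].

Lemma measurable_cons_tuple n : measurable_fun setT (@cons_tuple n).
Proof. exact: measurable_cons. Qed.

Section step.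
Variables (n : nat) (mn : {sigma_finite_measure set (n.-tuple T) -> \bar R}).

Definition power_step := pushforward (m \x mn)%E (@cons_tuple n).

Let step0 : power_step set0 = 0%E.
Proof. by rewrite /power_step /pushforward preimage_set0 measure0. Qed.

Let step_ge0 A : (0 <= power_step A)%E.
Proof. exact: (measure_ge0 (m \x mn)%E). Qed.

Let step_sigma_additive : semi_sigma_additive power_step.
Proof.
move=> F mF tF mUF; rewrite /power_step /pushforward preimage_bigcup.
have mp A : measurable A -> measurable (@cons_tuple n @^-1` A).
  by move=> mA; rewrite -[X in measurable X]setTI; exact: measurable_cons_tuple.
apply: measure_semi_sigma_additive.
- by move=> i; exact: mp.
- apply/trivIsetP => /= i j _ _ ij; rewrite -preimage_setI.
  by move/trivIsetP : tF => /(_ _ _ _ _ ij) ->//; rewrite preimage_set0.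
- by rewrite -preimage_bigcup; exact: mp.
Qed.

HB.instance Definition _ := isMeasure.Build _ _ _ power_step
  step0 step_ge0 step_sigma_additive.

Let step_sigma_finite : sigma_finite setT power_step.
Proof.
have /sigma_finiteP[F [TF ndF Foo]] := sigma_finiteT m.
have /sigma_finiteP[G [TG ndG Goo]] := sigma_finiteT mn.
pose g (t : n.+1.-tuple T) := (thead t, [tuple of behead t]).
have cg : cancel (@cons_tuple n) g.
  by case=> x t; rewrite /g /cons_tuple theadE; congr pair; exact/val_inj.
have gc : cancel g (@cons_tuple n) by move=> t; rewrite [RHS]tuple_eta.
have mg : measurable_fun setT g.
  by apply/measurable_fun_pair; [exact: measurable_tnth|exact: measurable_behead].
exists (fun i => g @^-1` (F i `*` G i)).
  apply/esym/seteqP; split => // t _.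
  have [a _ Fa] : (\bigcup_i F i) (g t).1 by rewrite -TF.
  have [b _ Gb] : (\bigcup_i G i) (g t).2 by rewrite -TG.
  exists (maxn a b) => //; split.
  - by move: (g t).1 Fa; exact/subsetPset/ndF/leq_maxl.
  - by move: (g t).2 Gb; exact/subsetPset/ndG/leq_maxr.
move=> i; have [mF Fi] := Foo i; have [mG Gi] := Goo i; split.
  by rewrite -[X in measurable X]setTI; apply: mg => //; exact: measurableX.
rewrite /power_step /pushforward -comp_preimage.
rewrite (_ : g \o @cons_tuple n = id); last by apply/funext => x /=; rewrite cg.
by rewrite preimage_id product_measure1E// lte_mul_pinfty// ge0_fin_numE.
Qed.

HB.instance Definition _ := Measure_isSigmaFinite.Build _ _ _ power_step
  step_sigma_finite.

End step.

Fixpoint power_measure n : {sigma_finite_measure set (n.-tuple T) -> \bar R} :=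
  match n with
  | 0 => dirac ([tuple] : 0.-tuple T)
  | k.+1 => power_step (power_measure k)
  end.

Lemma power_measure_box n (A : 'I_n -> set T) :
  (forall i, measurable (A i)) ->
  power_measure n [set t | forall i, A i (tnth t i)] =
  (\prod_(i < n) m (A i))%E.
Proof.
elim: n A => [|n IH] A mA.
  rewrite big_ord0 /= diracE mem_set//=; by case.
rewrite big_ord_recl -IH; last by [].
rewrite -product_measure1E//; last first.
  rewrite (_ : [set t | _] = \bigcap_(i in [set: 'I_n])
    ((@tnth _ T ^~ i) @^-1` A (lift ord0 i))).
    apply: fin_bigcap_measurable => // i _.
    by rewrite -[X in measurable X]setTI; exact: measurable_tnth.
  by apply/seteqP; split => t /= h i; [move=> _|]; exact: h.
rewrite /= /power_step /pushforward; congr (_ _).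
apply/seteqP; split => -[x t] /= => [h|[h0 h] i].
  split; first exact: (h ord0).
  by move=> i; have := h (lift ord0 i); rewrite /cons_tuple tnthS.
have [j ->|->] := unliftP ord0 i; last exact: h0.
by rewrite /cons_tuple tnthS; exact: h.
Qed.

End power_measure.

Section euclidean.
Context (R : realType).

Definition edist D (x y : 'rV[R]_D) : R :=
  Num.sqrt (\sum_i (x ord0 i - y ord0 i) ^+ 2).

(* Lebesgue measure of R^D, carried by the measurable space of D-tuples. *)
Definition lebesgue_pow D := power_measure (@lebesgue_measure R) D.

Definition to_row D (t : D.-tuple (measurableTypeR R)) : 'rV[R]_D :=
  \row_i tnth t i.

End euclidean.

Unset Implicit Arguments.

(* The k-th parameter set is [Theta k := par k @` coord_set k]: it is identified,
   through the injective parametrization [par k], with a compact subset of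
   R^(dim k), from which it gets its Euclidean distance and Lebesgue measure;
   nestedness is inclusion in the common set [point]. The model is
   Theta_infty = \bigcup_(k >= 1) Theta k, and Theta 0 is empty. *)
Record bayes_model {R : realType} {d} {Z : measurableType d}
    (mu : {measure set Z -> \bar R}) := BayesModel {
  point : Type ;
  dim : nat -> nat ;
  coord_set : forall k, set 'rV[R]_(dim k) ;
  par : forall k, 'rV[R]_(dim k) -> point ;
  par_inj : forall k, set_inj (coord_set k) (par k) ;
  coord_set0 : coord_set 0%N = set0 ;
  nested : forall k, par k @` coord_set k `<=` par k.+1 @` coord_set k.+1 ;
  coord_set_compact : forall k, (1 <= k)%N -> compact (coord_set k) ;
  fdens : point -> Z -> R ;
  Pdist : point -> probability Z R ;
  f_measurable : forall k x, coord_set k x -> measurable_fun setT (fdens (par k x)) ;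
  (* the log-densities are real-valued at every z *)
  f_gt0 : forall k x z, coord_set k x -> 0 < fdens (par k x) z ;
  f_density : forall k x A, coord_set k x -> measurable A ->
    Pdist (par k x) A = (\int[mu]_(z in A) (fdens (par k x) z)%:E)%E ;
  logf_continuous : forall k z, (1 <= k)%N ->
    {within coord_set k, continuous (fun x => ln (fdens (par k x) z))} ;
  theta_star : point ;
  k_star : nat ;
  order_gt0 : (1 <= k_star)%N ;
  theta_star_in :
    ((par k_star @` coord_set k_star) `\`
     (par k_star.-1 @` coord_set k_star.-1)) theta_star ;
  order_unique : forall k theta, (1 <= k)%N ->
    ((par k @` coord_set k) `\` (par k.-1 @` coord_set k.-1)) theta ->
    (forall A, measurable A -> Pdist theta A = Pdist theta_star A) -> k = k_star ;
  weight : nat -> R ;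
  weight_ge0 : forall k, (1 <= k)%N -> 0 <= weight k ;
  weight_sum1 : (\sum_(1 <= k <oo) (weight k)%:E = 1)%E ;
  (* density of pi_k with respect to Lebesgue measure, in the coordinates of
     Theta k *)
  prior_dens : forall k, 'rV[R]_(dim k) -> R ;
  dens_measurable : forall k, (1 <= k)%N ->
    measurable_fun (@to_row R (dim k) @^-1` coord_set k)
      (fun t => prior_dens k (to_row t)) ;
  dens_ge0 : forall k x, (1 <= k)%N -> coord_set k x -> 0 <= prior_dens k x ;
  dens_int1 : forall k, (1 <= k)%N ->
    (\int[lebesgue_pow R (dim k)]_(t in @to_row R (dim k) @^-1` coord_set k)
       (prior_dens k (to_row t))%:E = 1)%E
}.

Arguments point {R d Z mu} _.
Arguments dim {R d Z mu} _.
Arguments coord_set {R d Z mu} _.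
Arguments par {R d Z mu} _.
Arguments fdens {R d Z mu} _.
Arguments Pdist {R d Z mu} _.
Arguments theta_star {R d Z mu} _.
Arguments k_star {R d Z mu} _.
Arguments weight {R d Z mu} _.
Arguments prior_dens {R d Z mu} _.

Section model.
Context {R : realType} {d} {Z : measurableType d}
  {mu : {measure set Z -> \bar R}} (M : bayes_model mu).

Definition Theta k : set (point M) := par M k @` coord_set M k.

Definition f_star := fdens M (theta_star M).
Definition P_star := Pdist M (theta_star M).
Definition P_star_pow n := power_measure P_star n.

(* P_g (log g - log h)^2, where P_g has density g with respect to mu. No
   integrability of g is asked for: it follows from Vdiv g h < +oo when h is
   integrable, since g <= g * (log g - log h)^2 or g <= e * h. *)
Definition Vdiv (g h : Z -> R) : \bar R :=
  (\int[mu]_z (g z * (ln (g z) - ln (h z)) ^+ 2)%:E)%E.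

Definition KL (theta : point M) : \bar R :=
  (\int[P_star]_z (ln (f_star z) - ln (fdens M theta z))%:E)%E.

Definition H_star k : \bar R := ereal_inf (KL @` Theta k).

Definition Sset k (delta : R) : set (point M) :=
  [set theta | Theta k theta /\ (KL theta <= H_star k + (delta / 2)%:E)%E].

(* The balls below are those of Theta k, in coordinates; on the compact Theta k
   the sets of reals are bounded, so inf and sup are the genuine ones. *)
Definition eball k (x : 'rV[R]_(dim M k)) (delta : R) : set 'rV[R]_(dim M k) :=
  [set y | coord_set M k y /\ edist x y < delta].
Definition lower k (x : 'rV[R]_(dim M k)) (delta : R) (z : Z) : R :=
  inf [set fdens M (par M k y) z | y in eball k x delta].
Definition upper k (x : 'rV[R]_(dim M k)) (delta : R) (z : Z) : R :=
  sup [set fdens M (par M k y) z | y in eball k x delta].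

Definition qmoment (theta : point M) (alpha : R) : \bar R :=
  (\int[P_star]_z ((ln (f_star z) - ln (fdens M theta z)) ^+ 2 *
                   expR (alpha * (ln (f_star z) - ln (fdens M theta z))))%:E
   + Vdiv f_star (fdens M theta))%E.

(* pi_k B, for a set B of parameters *)
Definition prior_prob k (B : set (point M)) : \bar R :=
  (\int[lebesgue_pow R (dim M k)]_(t in
      [set t | coord_set M k (to_row t) /\ B (par M k (to_row t))])
      (prior_dens M k (to_row t))%:E)%E.

Definition marginal k n (z : n.-tuple Z) : \bar R :=
  (\int[lebesgue_pow R (dim M k)]_(t in @to_row R (dim M k) @^-1` coord_set M k)
     ((\prod_(i < n) fdens M (par M k (to_row t)) (tnth z i)) * prior_dens M k (to_row t))%:E)%E.

Definition evidence n (z : n.-tuple Z) : \bar R :=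
  (\sum_(1 <= k <oo) (weight M k)%:E * marginal k n z)%E.

(* Bayes' formula; where the evidence is +oo (a null event for the n-fold
   product of P_star), the value is 0 for every k. *)
Definition posterior k n (z : n.-tuple Z) : \bar R :=
  ((weight M k)%:E * marginal k n z / evidence n z)%E.

(* A global estimator is any measurable selection of the argmax, so that no
   tie-breaking rule is imposed. *)
Definition is_kG n (kG : n.-tuple Z -> nat) : Prop :=
  measurable_fun setT kG /\
  forall z, (1 <= kG z)%N /\
    forall k, (1 <= k)%N -> (posterior k n z <= posterior (kG z) n z)%E.

(* an extended real, equal to +oo if the posterior is increasing in k *)
Definition kL n (z : n.-tuple Z) : \bar R :=
  ereal_inf [set k%:R%:E | k in
    [set k | (1 <= k)%N /\ (posterior k.+1 n z <= posterior k n z)%E]].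

Definition A1 : Prop := forall k, (1 <= k)%N ->
  exists alpha delta0 B : R, [/\ 0 < alpha, 0 < delta0, 1 <= B &
    forall delta, 0 < delta -> delta <= delta0 ->
      (ereal_sup [set qmoment theta alpha | theta in Sset k delta] <= B%:E)%E].

Definition A2 : Prop := forall k (x : 'rV[R]_(dim M k)), (1 <= k)%N ->
  coord_set M k x ->
  exists2 eta : R, 0 < eta &
    (Vdiv (upper k x eta) f_star + Vdiv f_star (lower k x eta) + Vdiv f_star (upper k x eta)
     + Vdiv (upper k x eta) (fdens M (par M k x)) < +oo)%E.

End model.

(* Main.v *)
(* Write p for the density of the true law, E for its expectation and H_j for the least
   Kullback-Leibler divergence from it over Theta_j. If every theta in Theta_k has
   divergence > H_k', the posterior probabilities of k and k' are compared through the
   marginal likelihoods relative to the true product density.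

   Upper bound at k: for theta in Theta_k and u the upper bracket of radius delta around
   theta, E (u/p)^s <= exp(-s h) for some h > H_k' once s and delta are small. Indeed
   ((u/p)^s - 1)/s decreases to log(f_theta/p) when s = 2^-m and delta shrinks with m, so
   monotone convergence applies. By compactness finitely many such brackets dominate the
   whole marginal likelihood, and Markov's inequality makes it smaller than exp(-n b), for
   some b > H_k', up to exponentially small probability.

   Lower bound at k': by (A1) and a second order expansion of exp, for s small
   E (p/f_theta)^s <= exp(s b1) with b1 < b, uniformly on a set S_k'(delta), which is
   charged by the prior. Tonelli's theorem and the convexity of v |-> v^-s make the
   integral over that set larger than a multiple of exp(-n b), up to exponentially small
   probability.

   For the global estimator k' = k_star and H_k' = 0: no positive lower bound on the
   divergences over Theta_k is needed, since the finite cover yields a uniform b. *)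

Require Import Defs.
From mathcomp Require Import all_boot all_order all_algebra.
From mathcomp Require Import all_classical all_reals all_analysis.
From mathcomp Require Import measurable_realfun zify ring lra.
Import Order.TTheory GRing.Theory Num.Theory.
Import numFieldNormedType.Exports.
Local Open Scope classical_set_scope.
Local Open Scope ring_scope.

Local Notation edist := Defs.edist.

(** * Exponentials, densities and product measures *)

(** The bound [expR x * (1 - x) <= 1] gives [expR x - 1 - x <= x * (expR x - 1)]. The right side is
    at most [x ^+ 2 * expR x] for [x >= 0] and, by [1 + x <= expR x], at most [x ^+ 2] for
    [x < 0]. *)
Lemma expR_quadratic_le {R : realType} (x : R) :
  expR x <= 1 + x + x ^+ 2 * (1 + expR x).
Proof.
have h1 : expR x * (1 - x) <= 1.
  have := expR_ge1Dx (- x); rewrite expRN.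
  by rewrite -(ler_pM2l (expR_gt0 x)) divff ?gt_eqF ?expR_gt0.
have h2 := expR_ge1Dx x; have h3 := expR_gt0 x.
case: (leP 0 x) => x0; nra.
Qed.

(** The remainder involves the fixed exponent [a] and not [s], so that one moment of order [a], as
    in [qmoment], controls all [s <= a]. For this, [expR (s * y)] is bounded by [1 + expR (a * y)]
    whatever the sign of [y]. *)
Lemma expR_quadratic_scale_le {R : realType} (a s y : R) : 0 <= s -> s <= a ->
  expR (s * y) <=
    1 + s * y + s ^+ 2 * (y ^+ 2 *+ 2 + y ^+ 2 * expR (a * y)).
Proof.
move=> s0 sa; apply: le_trans (expR_quadratic_le _) _.
have h : expR (s * y) <= 1 + expR (a * y).
  case: (leP 0 y) => y0.
    by rewrite ler_wpDl// ler_expR ler_wpM2r.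
  apply: (@le_trans _ _ 1); first by rewrite -expR0 ler_expR; nra.
  by rewrite lerDl expR_ge0.
rewrite exprMn -mulrA lerD2l; apply: ler_wpM2l; first exact: sqr_ge0.
rewrite [leRHS](_ : _ = y ^+ 2 * (2 + expR (a * y))); last by ring.
by apply: ler_wpM2l; [exact: sqr_ge0 | lra].
Qed.

(* The tangent line of [v |-> v `^ (- s)] at [v = 1], with [v = expR x]. *)
Lemma expR_tangent_le {R : realType} (s x : R) : 0 <= s ->
  1 + s - s * expR x <= expR (- (s * x)).
Proof.
move=> s0; have h1 := expR_ge1Dx (- (s * x)); have h2 := expR_ge1Dx x.
by apply: le_trans h1; nra.
Qed.

Section density.
Context d (T : measurableType d) (R : realType).
Variables (mu : {measure set T -> \bar R}) (P : {measure set T -> \bar R}).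
Variable f : T -> R.
Hypothesis f0 : forall x, 0 <= f x.
Hypothesis mf : measurable_fun setT f.
Hypothesis Pf : forall A, measurable A -> P A = (\int[mu]_(x in A) (f x)%:E)%E.
Local Open Scope ereal_scope.
Import HBNNSimple.

(** The hypothesis [Pf] settles indicators; linearity extends it to simple functions and monotone
    convergence to nonnegative measurable [g]. *)
Lemma ge0_integral_density (g : T -> \bar R) : (forall x, 0 <= g x) ->
  measurable_fun setT g ->
  \int[P]_x g x = \int[mu]_x (g x * (f x)%:E).
Proof.
move=> g0 mg.
pose h := nnsfun_approx measurableT mg.
have mEf : measurable_fun setT (EFin \o f) by exact/measurable_EFinP.
have cvgh x : EFin \o h ^~ x @ \oo --> g x by exact: cvg_nnsfun_approx.
have ndh x a b : (a <= b)%N -> (h a x <= h b x)%R.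
  by move=> ab; exact/lefP/nd_nnsfun_approx.
have -> : \int[P]_x g x = limn (fun n => \int[P]_x (h n x)%:E).
  rewrite -monotone_convergence//.
  - by apply: eq_integral => x _; apply/esym/cvg_lim => //; exact: cvgh.
  - by move=> n; exact/measurable_EFinP/measurable_funP.
  - by move=> n x _; rewrite lee_fin.
  - by move=> x _ a b ab; rewrite lee_fin; exact: ndh.
have -> : \int[mu]_x (g x * (f x)%:E) =
    limn (fun n => \int[mu]_x ((h n x)%:E * (f x)%:E)).
  rewrite -monotone_convergence//.
  - apply: eq_integral => x _; apply/esym/cvg_lim => //.
    by apply: cvgeZr => //; exact: cvgh.
  - by move=> n; apply: emeasurable_funM => //; exact/measurable_EFinP/measurable_funP.
  - by move=> n x _; rewrite mule_ge0 ?lee_fin.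
  - by move=> x _ a b ab; rewrite lee_wpmul2r ?lee_fin ?f0 ?ndh.
congr (limn _); apply/funext => n.
have mi r : measurable_fun setT (fun x => (r * \1_(h n @^-1` [set r]) x)%:E).
  exact/measurable_EFinP/measurable_funM.
transitivity (\int[P]_x
    (\sum_(y \in range (h n)) (y * \1_(h n @^-1` [set y]) x)%:E)).
  by apply: eq_integral => t _; rewrite fimfunE -fsumEFin.
rewrite ge0_integral_fsum//; last first.
  by move=> m y Ey; exact: nnfun_muleindic_ge0.
transitivity (\int[mu]_x (\sum_(y \in range (h n))
    (y * \1_(h n @^-1` [set y]) x)%:E * (f x)%:E)); last first.
  apply: eq_integral => x _; rewrite fimfunE -fsumEFin// ge0_mule_fsuml// => y.
  exact: nnfun_muleindic_ge0.
rewrite ge0_integral_fsum//; last 2 first.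
  - by move=> y; exact: emeasurable_funM.
  - by move=> m y _; apply: mule_ge0; [exact: nnfun_muleindic_ge0|rewrite lee_fin f0].
apply: eq_fsbigr => r /[!inE] -[t _ rE].
have r0 : (0 <= r)%R by rewrite -rE.
have mr : measurable (h n @^-1` [set r]) by [].
under eq_integral do rewrite EFinM.
rewrite ge0_integralZl//; last by apply/measurable_EFinP.
rewrite integral_indic// setIT.
under [RHS]eq_integral do rewrite EFinM -muleA.
rewrite ge0_integralZl//; last 2 first.
  - by apply: emeasurable_funM => //; apply/measurable_EFinP.
  - by move=> x _; rewrite mule_ge0 ?lee_fin.
rewrite Pf//; congr (_ * _).
rewrite integral_mkcond; apply: eq_integral => x _.
by rewrite muleC epatch_indic.
Qed.

End density.

Section power_integral.
Context d (T : measurableType d) (R : realType).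
Variable P : {sigma_finite_measure set T -> \bar R}.
Local Open Scope ereal_scope.

Lemma measurable_sum_tnth n (phi : T -> R) : measurable_fun setT phi ->
  measurable_fun setT (fun t : n.-tuple T => \sum_(i < n) phi (tnth t i))%R.
Proof.
move=> mphi; apply: measurable_sum => i.
by apply: measurableT_comp => //; exact: measurable_tnth.
Qed.

(** Independence: the exponential of the sum splits off the first coordinate, and Tonelli's theorem
    applies to the binary product from which [power_measure] is built. *)
Lemma integral_power_expR n (phi : T -> R) : measurable_fun setT phi ->
  \int[power_measure P n]_t (expR (\sum_(i < n) phi (tnth t i)))%:E =
  (\int[P]_x (expR (phi x))%:E) ^+ n.
Proof.
move=> mphi; elim: n => [|n IH].
  rewrite integral_dirac//= ?diracT ?mul1e ?big_ord0 ?expR0 ?expe0//.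
  by apply/measurable_EFinP/measurableT_comp => //; exact: measurable_sum_tnth.
rewrite expeS /= ge0_integral_pushforward//; last 2 first.
- exact: measurable_cons_tuple.
- by apply/measurable_EFinP/measurableT_comp => //; exact: measurable_sum_tnth.
rewrite preimage_setT.
have E (x : T * n.-tuple T) :
    expR (\sum_(i < n.+1) phi (tnth (Defs.cons_tuple x) i)) =
    (expR (phi x.1) * expR (\sum_(i < n) phi (tnth x.2 i)))%R.
  rewrite big_ord_recl expRD; congr (_ * expR _)%R.
  by apply: eq_bigr => i _; rewrite /Defs.cons_tuple tnthS.
rewrite (eq_integral (fun x => (expR (phi x.1) *
    expR (\sum_(i < n) phi (tnth x.2 i)))%:E)); last by move=> x _ /=; rewrite E.
rewrite fubini_tonelli1//; last first.
  apply/measurable_EFinP/measurable_funM.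
    by apply: measurableT_comp => //; exact: measurableT_comp.
  apply: measurableT_comp => //.
  by apply: measurableT_comp (measurable_sum_tnth n phi mphi) _.
rewrite /fubini_F/=.
under eq_integral => x _.
  under eq_integral do rewrite EFinM.
  rewrite ge0_integralZl//; last first.
    by apply/measurable_EFinP/measurableT_comp => //; exact: measurable_sum_tnth.
  rewrite IH; over.
rewrite /= ge0_integralZr//.
- by apply/measurable_EFinP/measurableT_comp.
- by apply: expe_ge0; apply: integral_ge0 => x _; rewrite lee_fin expR_ge0.
Qed.

End power_integral.

(** * Compact parameter sets and joint measurability *)

Lemma invn_le {R : realType} {e : R} : 0 < e ->
  exists2 m : nat, 0 < (m.+1%:R^-1 : R) & m.+1%:R^-1 <= e.
Proof.
move=> e0; exists (Num.truncn e^-1); first by rewrite invr_gt0 ltr0n.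
rewrite -[leRHS]invrK lef_pV2 ?posrE ?invr_gt0 ?ltr0n//.
exact/ltW/truncnS_gt.
Qed.

Section euclidean_topology.
Context {R : realType} {D : nat}.
Implicit Types (x y : 'rV[R]_D) (C : set 'rV[R]_D).

Lemma edist_continuous x : continuous (edist x : 'rV[R]_D -> R).
Proof.
have hi (i : 'I_D) : continuous (fun y : 'rV[R]_D => (x ord0 i - y ord0 i) ^+ 2 : R).
  move=> y; apply: (@continuous_comp _ _ _ (fun z : 'rV[R]_D => z ord0 i)
    (fun v : R => (x ord0 i - v) ^+ 2)); first exact: coord_continuous.
  apply: (@continuous_comp _ _ _ (fun v : R => x ord0 i - v) (fun v : R => v ^+ 2)).
    by apply: continuousB => //; exact: cst_continuous.
  exact: exprn_continuous.
have h (r : seq 'I_D) :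
    continuous (fun y : 'rV[R]_D => \sum_(i <- r) (x ord0 i - y ord0 i) ^+ 2 : R).
  elim: r => [|i r IH] y.
    under eq_fun do rewrite big_nil.
    exact: cst_continuous.
  under eq_fun do rewrite big_cons.
  exact: (continuousD (hi i y) (IH y)).
move=> y; apply: (@continuous_comp _ _ _ _ (@Num.sqrt R)); first exact: h.
exact: sqrt_continuous.
Qed.

Lemma open_edist_ball x (e : R) : open [set y | edist x y < e].
Proof.
apply: (@open_comp _ _ (edist x) [set r | r < e]); last exact: open_lt.
by move=> y _; exact: edist_continuous.
Qed.

Lemma edistxx x : edist x x = 0.
Proof. by rewrite /edist big1 ?sqrtr0// => i _; rewrite subrr expr0n. Qed.

Lemma edist_finite_cover {C} (r : 'rV[R]_D -> R) : compact C ->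
  (forall x, C x -> 0 < r x) ->
  exists2 s : seq 'rV[R]_D, (forall x, x \in s -> C x) &
    (forall y, C y -> exists2 x, x \in s & edist x y < r x).
Proof.
rewrite compact_cover => cC r0.
have [|y Cy|s sC Cs] := cC _ C (fun x => [set y | edist x y < r x]).
- by move=> x _; exact: open_edist_ball.
- by exists y => //=; rewrite edistxx r0.
- exists (finmap.enum_fset s) => [x /sC|y /Cs[x xs xy]]; first by rewrite inE.
  by exists x.
Qed.

Lemma within_continuous_ball {C} {g : 'rV[R]_D -> R} {x} (e : R) :
  {within C, continuous g} -> C x -> 0 < e ->
  exists2 r : R, 0 < r &
    forall y, C y -> ball x r y -> `|g x - g y| < e.
Proof.
move=> /subspace_continuousP cg Cx e0.
have /cvgrPdist_lt/(_ _ e0) := cg _ Cx.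
rewrite near_withinE => /nbhs_ballP[r /= r0 h]; exists r => // y Cy xy.
exact: h.
Qed.

(** [C] may contain no rational point. For each ball with rational centre and radius [1 / (m + 1)],
    a point of [C] in it is chosen if there is one, and [x0] otherwise; two points of the same ball
    are within twice its radius. *)
Lemma dense_sequence {C} : C !=set0 ->
  exists2 u : nat -> 'rV[R]_D, (forall j, C (u j)) &
    (forall x (e : R), C x -> 0 < e -> exists j, ball (u j) e x).
Proof.
move=> [x0 Cx0].
pose Q (p : 'rV[rat]_D * nat) : 'rV[R]_D -> Prop :=
  [set y | C y /\ ball (map_mx ratr p.1 : 'rV[R]_D) (p.2.+1%:R^-1 : R) y].
pose u j : 'rV[R]_D := if unpickle j is Some p then xget x0 (Q p) else x0.
have uC j : C (u j).
  rewrite /u; case: unpickle => // p.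
  by case: xgetP => [y _ []|_].
exists u => // x e Cx e0.
have e20 : 0 < e / 2 by rewrite divr_gt0.
have [m m0 mE] := invn_le e20.
have /choice[q hq] : forall i : 'I_D, exists q : rat,
    ball (ratr q : R) (m.+1%:R^-1 : R) (x ord0 i).
  move=> i.
  move: (m.+1%:R^-1) m0 => r r0.
  have [|q /=] := @rat_in_itvoo R (x ord0 i - r) (x ord0 i + r); first by lra.
  rewrite in_itv/= => /andP[q1 q2]; exists q.
  by rewrite /ball/= ltr_norml; apply/andP; split; lra.
pose p : 'rV[rat]_D * nat := (\row_i q i, m).
have pb : ball (map_mx ratr p.1 : 'rV[R]_D) (p.2.+1%:R^-1 : R) x.
  by split => // i j; rewrite !mxE (ord1 i).
exists (pickle p); rewrite /u pickleK.
case: xgetP => [y _ [Cy py]|/(_ x)]; last by case.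
apply: (@le_ball _ _ _ (m.+1%:R^-1 + m.+1%:R^-1)).
  by rewrite [leRHS]splitr lerD.
by apply: ball_triangle (pb); exact: ball_sym.
Qed.

(** The ball is that of the sup norm, so its preimage is a box. *)
Lemma to_row_ball_measurable x (e : R) :
  measurable [set t : D.-tuple (measurableTypeR R) | ball x e (to_row t)].
Proof.
have [e0|e0] := ltP 0 e; last first.
  by rewrite (_ : mkset _ = set0)//; apply/seteqP; split => // t [/lt_geF]; rewrite e0.
rewrite (_ : mkset _ = \bigcap_(i in [set: 'I_D])
   ((@tnth _ (measurableTypeR R) ^~ i) @^-1` (ball (x ord0 i) e))); last first.
  apply/seteqP; split => t.
    by move=> [_ h] i _; have := h ord0 i; rewrite /to_row mxE.
  by move=> h; split => // i j; rewrite ord1 /to_row mxE; exact: h.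
apply: fin_bigcap_measurable => // i _.
rewrite -[X in measurable X]setTI; apply: measurable_tnth => //.
exact: measurable_ball.
Qed.

(** A closed set consists of the points arbitrarily close to a dense sequence of it, which is a
    countable condition on balls. *)
Lemma to_row_preimage_measurable {C} : closed C ->
  measurable [set t : D.-tuple (measurableTypeR R) | C (to_row t)].
Proof.
move=> cC; have [->|/set0P/dense_sequence[u uC du]] := eqVneq C set0.
  exact: measurable0.
rewrite (_ : mkset _ = \bigcap_m \bigcup_j
   [set t : D.-tuple (measurableTypeR R) | ball (u j) (m.+1%:R^-1 : R) (to_row t)]).
  apply: bigcapT_measurable => m; apply: bigcupT_measurable => j.
  exact: to_row_ball_measurable.
apply/seteqP; split => t /=.
  by move=> Ct m _; have [//|j hj] := du _ m.+1%:R^-1 Ct; exists j.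
move=> h; apply: cC => B /nbhs_ballP[e /= e0 eB].
have [m _ mE] := invn_le e0.
have [j _ hj] := h m Logic.I.
by exists (u j); split => //; apply/eB/ball_sym; exact: le_ball hj.
Qed.

(* [g t z > c] holds iff, for some margin [1 / p], points [u j] of a dense sequence
   arbitrarily close to [t] satisfy [g (u j) z > c + 1 / p]. *)
Lemma within_continuous_measurable_prod d (Z : measurableType d) C
    (g : 'rV[R]_D -> Z -> R) : closed C ->
  (forall z, {within C, continuous (g ^~ z)}) ->
  (forall x, C x -> measurable_fun setT (g x)) ->
  measurable_fun [set p : D.-tuple (measurableTypeR R) * Z | C (to_row p.1)]
    (fun p => g (to_row p.1) p.2).
Proof.
move=> cC cg mg.
have [C0|/set0P/dense_sequence[u uC du]] := eqVneq C set0.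
  rewrite (_ : mkset _ = set0); first exact: measurable_fun_set0.
  by apply/seteqP; split => // p; rewrite C0.
pose A c p m j : set (D.-tuple (measurableTypeR R) * Z) :=
  [set t | ball (u j) (m.+1%:R^-1 : R) (to_row t)] `*`
  (g (u j) @^-1` `]c + p.+1%:R^-1, +oo[).
move=> mD; apply: (measurability _ (RGenOInfty.measurableE R)) => //.
move=> _ [_ [c ->] <-].
rewrite (_ : _ `&` _ = [set p : D.-tuple (measurableTypeR R) * Z | C (to_row p.1)] `&`
    \bigcup_p \bigcap_m \bigcup_j A c p m j).
  apply: measurableI => //; apply: bigcupT_measurable => p.
  apply: bigcapT_measurable => m; apply: bigcupT_measurable => j.
  apply: measurableX; first exact: to_row_ball_measurable.
  by rewrite -[X in measurable X]setTI; apply: mg.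
apply/seteqP; split => -[t z] /= [Ct]; rewrite ?in_itv/= ?andbT => h; split => //.
- pose e := (g (to_row t) z - c) / 2.
  have e0 : 0 < e by rewrite divr_gt0// subr_gt0.
  have [p p0 pe] := invn_le e0.
  exists p => // m _.
  have [r r0 hr] := within_continuous_ball e (cg z) Ct e0.
  have m0 : 0 < Num.min r (m.+1%:R^-1) by rewrite lt_min r0 invr_gt0 ltr0n.
  have [j hj] := du _ _ Ct m0.
  exists j => //; split => /=; first by apply: le_ball hj; rewrite ge_min lexx orbT.
  rewrite in_itv/= andbT.
  have : `|g (to_row t) z - g (u j) z| < e.
    by apply: hr => //; apply/ball_sym; apply: le_ball hj; rewrite ge_min lexx.
  move: (p.+1%:R^-1) p0 pe => q q0; rewrite ltr_norml /e => qe /andP[h2 h3].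
  by lra.
- move: h => [p _ h].
  have p0 : 0 < (p.+1%:R^-1 : R) by rewrite invr_gt0 ltr0n.
  have [r r0 hr] := within_continuous_ball _ (cg z) Ct p0.
  have [m m0 mr] := invn_le r0.
  have [j _ [/= hj]] := h m Logic.I.
  rewrite in_itv/= andbT => gj.
  have : `|g (to_row t) z - g (u j) z| < p.+1%:R^-1.
    apply: hr => //; apply/ball_sym; exact: le_ball hj.
  move: (p.+1%:R^-1) p0 gj => q q0 gj; rewrite ltr_norml => /andP[h1 h2]; lra.
Qed.

End euclidean_topology.

(** * Exponential moments *)

Section exponential_moments.
Context d (T : measurableType d) (R : realType).
Variable P : probability T R.
Implicit Types (f g Y : T -> R).
Local Open Scope ereal_scope.

(** Positive parts compare one way and negative parts the other, and subtraction of extended reals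
    is monotone even at infinite values. Divergences equal to [+oo] are thus covered. *)
Lemma le_integral_measurable (f g : T -> \bar R) :
  measurable_fun setT f -> measurable_fun setT g -> (forall x, f x <= g x) ->
  \int[P]_x f x <= \int[P]_x g x.
Proof.
move=> mf mg fg; rewrite integralE [leRHS]integralE; apply: leeB.
- apply: ge0_le_integral => //; [exact: measurable_funepos..|].
  by move=> x _; apply: (@funepos_le _ _ setT); rewrite ?inE // => y _; exact: fg.
- apply: ge0_le_integral => //; [exact: measurable_funeneg..|].
  by move=> x _; apply: (@funeneg_le _ _ setT); rewrite ?inE // => y _; exact: fg.
Qed.

Lemma integral1_probability : \int[P]_x 1 = 1.
Proof. by rewrite integral_cst// mul1e; exact: probability_setT. Qed.

Lemma integrable_cst_probability (r : R) : P.-integrable setT (fun=> r%:E).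
Proof. by apply: finite_measure_integrable_cst. Qed.

Lemma ge0_integrable f : measurable_fun setT f -> (forall x, 0 <= f x)%R ->
  \int[P]_x (f x)%:E < +oo -> P.-integrable setT (EFin \o f).
Proof.
move=> mf f0 foo; apply/integrableP; split; first exact/measurable_EFinP.
by under eq_integral do rewrite gee0_abs ?lee_fin ?f0//.
Qed.

Lemma integrable_expR Y : measurable_fun setT Y ->
  \int[P]_x (expR (Y x))%:E < +oo ->
  P.-integrable setT (fun x => (expR (Y x))%:E).
Proof.
move=> mY; apply: ge0_integrable => [|x]; last exact: expR_ge0.
exact: measurableT_comp.
Qed.

(** [Y >= 1 - expR (- Y)], and the right side has mean 0. With [Y] a log-likelihood ratio, this is
    the nonnegativity of the Kullback-Leibler divergence. *)
Lemma integral_expRN_ge0 Y : measurable_fun setT Y ->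
  \int[P]_x (expR (- Y x))%:E = 1 -> 0 <= \int[P]_x (Y x)%:E.
Proof.
move=> mY Y1.
have mN : measurable_fun setT (\- Y)%R by exact: measurable_funN.
have iY : P.-integrable setT (fun x => (expR (- Y x))%:E).
  by apply: integrable_expR => //; rewrite Y1 ltry.
have i1 : P.-integrable setT (fun=> 1) by exact: (integrable_cst_probability 1).
have <- : \int[P]_x (1 - (expR (- Y x))%:E) = 0.
  by rewrite integralB// integral1_probability Y1 subee.
apply: le_integral_measurable.
- by have /measurable_int := integrableB measurableT i1 iY.
- exact/measurable_EFinP.
- by move=> x; rewrite -EFinB lee_fin; have := expR_ge1Dx (- Y x); lra.
Qed.

(** Equality case: [w = expR (- Y) - 1 + Y] is nonnegative with zero mean, so it vanishes almost
    everywhere, and [1 + u < expR u] for nonzero [u] forces [Y = 0] there. *)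
Lemma integral_expRN_eq0 Y : measurable_fun setT Y ->
  \int[P]_x (expR (- Y x))%:E = 1 -> \int[P]_x (Y x)%:E = 0 ->
  ae_eq P setT (fun x => (expR (- Y x))%:E) (cst 1).
Proof.
move=> mY Y1 Y0.
have mN : measurable_fun setT (\- Y)%R by exact: measurable_funN.
have iY : P.-integrable setT (fun x => (expR (- Y x))%:E).
  by apply: integrable_expR => //; rewrite Y1 ltry.
pose w x := (expR (- Y x) - 1 + Y x)%R.
have w0 x : (0 <= w x)%R by rewrite /w; have := expR_ge1Dx (- Y x); lra.
have mw : measurable_fun setT w.
  apply: measurable_funD => //; apply: measurable_funB => //.
  exact: measurableT_comp.
(* The negative part of [Y] is dominated by [expR (- Y)]; the positive part then has a finite
   integral, since the difference of the two is 0. *)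
have iY' : P.-integrable setT (EFin \o Y).
  apply/integrableP; split; first exact/measurable_EFinP.
  have mE : measurable_fun setT (EFin \o Y) by exact/measurable_EFinP.
  have negoo : \int[P]_x ((EFin \o Y)^\- x) < +oo.
    rewrite (le_lt_trans _ (ltry 1))// -Y1; apply: ge0_le_integral => //.
    + exact: measurable_funeneg.
    + exact: measurable_int iY.
    + move=> x _; rewrite funenegE -EFinN ge_max !lee_fin expR_ge0 andbT.
      by have := expR_ge1Dx (- Y x); lra.
  have posoo : \int[P]_x ((EFin \o Y)^\+ x) < +oo.
    move: Y0; rewrite integralE; move: negoo.
    have : 0 <= \int[P]_x ((EFin \o Y)^\- x) by apply: integral_ge0.
    by case: (integral _ _ _) => // r _ _; case: (integral _ _ _) => //= s _; rewrite ltry.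
  rewrite -[X in integral _ _ X]/(abse \o (EFin \o Y)) fune_abse.
  rewrite ge0_integralD//; first by rewrite lte_add_pinfty.
  - exact: measurable_funepos.
  - exact: measurable_funeneg.
have i1 : P.-integrable setT (fun=> 1) by exact: (integrable_cst_probability 1).
have iw : \int[P]_x `|(w x)%:E| = 0.
  under eq_integral do rewrite gee0_abs ?lee_fin ?w0//.
  rewrite (eq_integral (fun x => ((expR (- Y x))%:E - 1) + (Y x)%:E))//.
  rewrite integralD//; last exact: integrableB.
  by rewrite integralB// Y1 integral1_probability Y0 adde0 subee.
have /measurable_EFinP/(ae_eq_integral_abs P measurableT) [/(_ iw)] := mw.
move=> h _; apply: filterS h => x /(_ Logic.I) /= [wx0] _.
congr EFin; have [->|Yx] := eqVneq (Y x) 0%R; first by rewrite oppr0 expR0.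
have : (- Y x != 0)%R by rewrite oppr_eq0.
by move=> /expR_gt1Dx; move: wx0; rewrite /w; lra.
Qed.

(** Integrate [expR_quadratic_scale_le] and conclude by [1 + u <= expR u]. The two second moments
    are those of [qmoment]; the remainder counts the plain one twice, whence [2 * s * B]. *)
Lemma integral_expR_le Y (a b s B : R) : measurable_fun setT Y ->
  (0 <= s <= a)%R -> (0 <= B)%R -> \int[P]_x (Y x)%:E <= b%:E ->
  \int[P]_x (Y x ^+ 2 * expR (a * Y x))%:E + \int[P]_x (Y x ^+ 2)%:E <= B%:E ->
  \int[P]_x (expR (s * Y x))%:E <= (expR (s * (b + 2 * s * B)))%:E.
Proof.
move=> mY /andP[s0 sa] B0 Yb YB.
have mY2 : measurable_fun setT (fun x => Y x ^+ 2)%R by exact: measurable_funX.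
have mYe : measurable_fun setT (fun x => Y x ^+ 2 * expR (a * Y x))%R.
  apply: measurable_funM => //; apply: measurableT_comp => //.
  exact: measurable_funM.
have p1 : 0 <= \int[P]_x (Y x ^+ 2 * expR (a * Y x))%:E.
  by apply: integral_ge0 => x _; rewrite lee_fin mulr_ge0 ?expR_ge0 ?sqr_ge0.
have p2 : 0 <= \int[P]_x (Y x ^+ 2)%:E.
  by apply: integral_ge0 => x _; rewrite lee_fin sqr_ge0.
have i1 : P.-integrable setT (fun=> 1) by exact: (integrable_cst_probability 1).
have ie : P.-integrable setT (fun x => (Y x ^+ 2 * expR (a * Y x))%:E).
  apply: ge0_integrable => //; first by move=> x; rewrite mulr_ge0 ?expR_ge0 ?sqr_ge0.
  by rewrite (le_lt_trans _ (ltry B))// (le_trans _ YB)// leeDl.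
have i2 : P.-integrable setT (fun x => (Y x ^+ 2)%:E).
  apply: ge0_integrable => //; first by move=> x; rewrite sqr_ge0.
  by rewrite (le_lt_trans _ (ltry B))// (le_trans _ YB)// leeDr.
have iY : P.-integrable setT (fun x => (Y x)%:E).
  apply: (le_integrable _ _ (g := fun x => 1 + (Y x ^+ 2)%:E)) => //.
  - exact/measurable_EFinP.
  - move=> x _; rewrite -EFinD !abse_EFin lee_fin.
    rewrite [leRHS]ger0_norm ?addr_ge0 ?sqr_ge0//.
    by rewrite ler_norml; apply/andP; split; nra.
  - exact: integrableD.
pose q x : \bar R := (Y x ^+ 2)%:E + ((Y x ^+ 2)%:E + (Y x ^+ 2 * expR (a * Y x))%:E).
have iq : P.-integrable setT q by do 2 apply: integrableD => //.
have i1Y : P.-integrable setT (fun x => 1 + s%:E * (Y x)%:E).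
  by apply: integrableD => //; exact: integrableZl.
have isq : P.-integrable setT (fun x => (s ^+ 2)%:E * q x) by exact: integrableZl.
apply: (@le_trans _ _ (\int[P]_x (1 + s%:E * (Y x)%:E + (s ^+ 2)%:E * q x))).
  apply: ge0_le_integral => //.
  - apply/measurable_EFinP; apply: measurableT_comp => //.
    exact: measurable_funM.
  - by apply: measurable_int (integrableD _ i1Y isq).
  - move=> x _; rewrite /q -!EFinD lee_fin.
    apply: le_trans (expR_quadratic_scale_le _ _ _ s0 sa) _.
    by rewrite mulr2n addrA.
rewrite integralD// integralD//; last exact: integrableZl.
rewrite integralZl// integralZl// integral1_probability /q.
rewrite integralD//; last exact: integrableD.
rewrite integralD//.
move: p1 p2 Yb YB.
have : \int[P]_x (Y x)%:E \is a fin_num by exact: integrable_fin_num.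
move: (\int[P]_x (Y x)%:E) => y; case: y => // y _.
case: (integral _ _ _) => // u; last by case: (integral _ _ _).
case: (integral _ _ _) => // v.
rewrite -!EFinD !lee_fin => u0 v0 yb uvB.
apply: le_trans (expR_ge1Dx _).
by rewrite -addrA lerD2l; nra.
Qed.

End exponential_moments.

Arguments integral1_probability {d T R} P.

(** * Exponential moments along vanishing exponents *)

Section decreasing_exponents.
Context d (T : measurableType d) (R : realType).
Variable P : probability T R.
Variables (v : nat -> T -> R) (w : T -> R).
Hypothesis mv : forall m, measurable_fun setT (v m).
Hypothesis mw : measurable_fun setT w.
Hypothesis vS : forall m x, v m.+1 x <= v m x.
Hypothesis vw : forall x, v ^~ x @ \oo --> w x.
Hypothesis v0oo : (\int[P]_x (expR (v 0%N x))%:E < +oo)%E.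

Let s m : R := 2^-1 ^+ m.
Let s0 m : 0 < s m. Proof. by rewrite exprn_gt0// invr_gt0. Qed.
(** Difference quotient at 0 of [r |-> expR (r * v m x)], whose derivative there is [v m x]. *)
Let psi m x := (s m)^-1 * (expR (s m * v m x) - 1).

(** Lowering [v] lowers the quotient, and so does halving the exponent: with [r = s m.+1] and
    [e = expR (r * v m x)], the two quotients differ by [(e - 1) ^+ 2 / (2 * r)]. *)
Let psiS m x : psi m.+1 x <= psi m x.
Proof.
apply: (@le_trans _ _ ((s m.+1)^-1 * (expR (s m.+1 * v m x) - 1))).
  by rewrite ler_pM2l ?invr_gt0// lerD2r ler_expR ler_pM2l.
rewrite /psi; have -> : s m = 2 * s m.+1 by rewrite /s exprS mulrA divff ?mul1r.
set r := s m.+1; have r0 : 0 < r by exact: s0.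
rewrite -mulrA [_ * (r * _)]mulrC mulr_natr mulr2n expRD invfM.
set e := expR _; rewrite -subr_ge0.
have -> : 2^-1 * r^-1 * (e * e - 1) - r^-1 * (e - 1) = 2^-1 * r^-1 * (e - 1) ^+ 2.
  by field; rewrite gt_eqF.
by rewrite mulr_ge0 ?sqr_ge0// mulr_ge0 ?invr_ge0// ltW.
Qed.

(** Squeezed between [v m x] and [v m x * expR (s m * v m x)], which both tend to [w x]. *)
Let psi_cvg x : psi ^~ x @ \oo --> w x.
Proof.
have scvg : s @ \oo --> (0 : R).
  apply: cvg_expr; rewrite ger0_norm ?invr_ge0//.
  by rewrite invf_lt1 ?ltr1n.
have sv : (fun m => s m * v m x) @ \oo --> 0.
  by rewrite -(mul0r (w x)); exact: cvgM.
have ev : (fun m => expR (s m * v m x)) @ \oo --> (1 : R).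
  by rewrite -expR0; apply: continuous_cvg => //; exact: continuous_expR.
have ub : (fun m => v m x * expR (s m * v m x)) @ \oo --> w x.
  by rewrite -(mulr1 (w x)); exact: cvgM.
apply: (@squeeze_cvgr _ _ _ _ (v ^~ x) (fun m => v m x * expR (s m * v m x))) => //.
near=> m; have sm := s0 m.
have h1 := expR_ge1Dx (s m * v m x).
have h2 : expR (s m * v m x) * (1 - s m * v m x) <= 1.
  have := expR_ge1Dx (- (s m * v m x)); rewrite expRN.
  by rewrite -(ler_pM2l (expR_gt0 (s m * v m x))) divff ?gt_eqF ?expR_gt0.
rewrite /psi mulrC; apply/andP; split.
  by rewrite ler_pdivlMr//; lra.
by rewrite ler_pdivrMr//; lra.
Unshelve. all: by end_near. Qed.

(** By contradiction: if every moment exceeds [expR (- (s m * h)) >= 1 - s m * h], then every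
    [psi m] has mean at least [- h], and so has the limit [w], against the assumption on [h]. *)
Lemma decreasing_exponents_cvg (h : R) : (h%:E < \int[P]_x (- w x)%:E)%E ->
  exists m, (\int[P]_x (expR (2^-1 ^+ m * v m x))%:E <= (expR (- (2^-1 ^+ m * h)))%:E)%E.
Proof.
move=> hw; apply: contrapT => /forallNP noh.
have mpsi m : measurable_fun setT (psi m).
  apply: measurable_funM => //; apply: measurable_funB => //.
  by apply: measurableT_comp => //; exact: measurable_funM.
have psi_le0 m x : psi m x <= psi 0%N x.
  by elim: m => // m; exact: le_trans (psiS m x).
have psi0E x : psi 0%N x = expR (v 0%N x) - 1.
  by rewrite /psi /s expr0 invr1 !mul1r.
have i1 r : P.-integrable setT (fun=> r%:E) by exact: integrable_cst_probability.
have i0 : P.-integrable setT (EFin \o psi 0%N).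
  rewrite (_ : _ \o _ = fun x => (expR (v 0%N x))%:E - 1)%E; last first.
    by apply/funext => x /=; rewrite psi0E.
  by apply: integrableB => //; exact: integrable_expR.
have ipsi m : P.-integrable setT (EFin \o psi m).
  apply: (le_integrable _ _ (g := fun x => (expR (v 0%N x) + 1 + (s m)^-1)%:E)) => //.
  - exact/measurable_EFinP.
  - move=> x _; rewrite !abse_EFin lee_fin.
    rewrite [leRHS]ger0_norm; last by rewrite !addr_ge0 ?expR_ge0 ?invr_ge0// ltW.
    rewrite ler_norml; apply/andP; split; last first.
      apply: le_trans (psi_le0 _ _) _; rewrite psi0E.
      have : 0 < (s m)^-1 by rewrite invr_gt0.
      by lra.
    rewrite /psi; have := expR_ge0 (v 0%N x).
    have := expR_ge0 (s m * v m x).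
    have : 0 < (s m)^-1 by rewrite invr_gt0.
    by nra.
  - rewrite (_ : (fun=> _) = fun x => (expR (v 0%N x))%:E + (1 + (s m)^-1)%:E)%E.
      by apply: integrableD => //; exact: integrable_expR.
    by apply/funext => x; rewrite -EFinD addrA.
pose p m := fine (\int[P]_x (psi m x)%:E)%E.
have pE m : (\int[P]_x (psi m x)%:E)%E = (p m)%:E.
  by rewrite fineK//; exact: integrable_fin_num (ipsi m).
have ph m : - h <= p m.
  have := noh m; move/negP; rewrite -ltNge.
  rewrite (eq_integral (fun x => 1 + (s m)%:E * (psi m x)%:E)%E); last first.
    move=> x _; rewrite -EFinM -EFinD; congr EFin.
    by rewrite /psi mulrA divff ?gt_eqF// mul1r addrC subrK.
  rewrite integralD//; last exact: (integrableZl measurableT (s m) (ipsi m)).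
  rewrite (integralZl measurableT (ipsi m)) (integral1_probability P) pE -EFinM -EFinD lte_fin => hm.
  have := expR_ge1Dx (- (s m * h)); rewrite -/(s m) in hm.
  by have sm := s0 m; nra.
(* [psi m] has no sign, so monotone convergence is applied to the nonnegative increasing differences
   [D m]. *)
pose D m x := psi 0%N x - psi m x.
have D0 m x : 0 <= D m x by rewrite subr_ge0.
have mD m : measurable_fun setT (fun x => (D m x)%:E).
  by apply/measurable_EFinP; exact: measurable_funB.
have DS x : {homo D ^~ x : m n / (m <= n)%N >-> m <= n}.
  by apply/nondecreasing_seqP => m; rewrite lerD2l lerN2; exact: psiS.
have Dp m : (\int[P]_x (D m x)%:E = (p 0%N - p m)%:E)%E.
  rewrite EFinB -!pE -integralB//; exact: ipsi.
have Dlim : (\int[P]_x (psi 0%N x - w x)%:E <= (p 0%N + h)%:E)%E.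
  have Dcvg x : (fun m => (D m x)%:E) @ \oo --> (psi 0%N x - w x)%:E.
    apply: cvg_EFin; first exact: nearW.
    by apply: cvgB; [exact: cvg_cst|exact: psi_cvg].
  rewrite (eq_integral (fun x => limn (fun m => (D m x)%:E))); last first.
    by move=> x _; apply/esym/cvg_lim => //; exact: Dcvg.
  rewrite monotone_convergence//; last 2 first.
  - by move=> m x _; rewrite lee_fin.
  - move=> x _ m n mn; rewrite lee_fin. exact: DS.
  apply: lime_le; last first.
    by apply: nearW => m; rewrite Dp lee_fin lerD2l lerNl.
  apply: ereal_nondecreasing_is_cvgn => m n mn; apply: ge0_le_integral => //.
    by move=> x _; rewrite lee_fin.
  by move=> x _; rewrite lee_fin; exact: DS.
have wpsi0 x : 0 <= psi 0%N x - w x.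
  rewrite subr_ge0; rewrite -(cvg_lim _ (psi_cvg x))//.
  apply: limr_le; first by apply: cvgP; exact: psi_cvg.
  by apply: nearW => m; exact: psi_le0.
(* The mean of [- w] could a priori be [+oo]; under the negated conclusion [w] is a difference of
   integrable functions, so its integral splits. *)
have iw : P.-integrable setT (fun x => (psi 0%N x - w x)%:E).
  apply: ge0_integrable => //; first exact: measurable_funB.
  exact: le_lt_trans Dlim (ltry _).
move: hw; rewrite (eq_integral (fun x => (psi 0%N x - w x)%:E - (psi 0%N x)%:E)%E); last first.
  by move=> x _; rewrite -EFinB; congr EFin; ring.
rewrite integralB// pE; move: Dlim.
have : (\int[P]_x (psi 0%N x - w x)%:E)%E \is a fin_num by exact: integrable_fin_num.
case: (integral _ _ _) => // r _; rewrite -EFinB lee_fin lte_fin; lra.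
Qed.

End decreasing_exponents.

(** * Likelihood ratios and brackets *)

#[local] Arguments f_measurable {R d Z mu} _ {k x}.
#[local] Arguments f_gt0 {R d Z mu} _ {k x} z.
#[local] Arguments f_density {R d Z mu} _ {k x A}.
#[local] Arguments order_unique {R d Z mu} _ k theta.
#[local] Arguments logf_continuous {R d Z mu} _ {k} z.
#[local] Arguments coord_set0 {R d Z mu} _.
#[local] Arguments coord_set_compact {R d Z mu} _ {k}.
#[local] Arguments theta_star_in {R d Z mu} _.

(** The Euclidean distance dominates the sup norm that defines [ball]. *)
Lemma edist_ball {R : realType} {D : nat} (x y : 'rV[R]_D) (e : R) :
  edist x y < e -> ball x e y.
Proof.
move=> xy; split; first by rewrite (le_lt_trans _ xy)// sqrtr_ge0.
move=> i j; rewrite (ord1 i) /ball/=; apply: le_lt_trans xy.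
rewrite -sqrtr_sqr /Defs.edist ler_sqrt ?sumr_ge0// => [|l _]; last exact: sqr_ge0.
by rewrite (bigD1 j)//= lerDl sumr_ge0// => l _; exact: sqr_ge0.
Qed.

Section likelihood_ratio.
Context {R : realType} {d : measure_display} {Z : measurableType d}
  {mu : {measure set Z -> \bar R}} (M : bayes_model mu).

(** Log-likelihood ratio of one observation: its mean under [P_star M] is [KL], and
    [expR (- loss k x z)] is the density of the law at [x] with respect to [P_star M]. *)
Definition loss k x z : R := ln (f_star M z) - ln (fdens M (par M k x) z).

Lemma theta_star_par :
  exists2 x, coord_set M (k_star M) x & par M (k_star M) x = theta_star M.
Proof. by have [[x Cx xE] _] := theta_star_in M; exists x. Qed.

Lemma f_star_gt0 z : 0 < f_star M z.
Proof. by have [x Cx xE] := theta_star_par; rewrite /f_star -xE; exact: f_gt0. Qed.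

Lemma f_star_measurable : measurable_fun setT (f_star M).
Proof.
by have [x Cx xE] := theta_star_par; rewrite /f_star -xE; exact: f_measurable.
Qed.

Lemma integral_P_star (g : Z -> \bar R) : (forall z, (0 <= g z)%E) ->
  measurable_fun setT g ->
  (\int[P_star M]_z g z = \int[mu]_z (g z * (f_star M z)%:E))%E.
Proof.
move=> g0 mg; apply: ge0_integral_density => //.
- by move=> z; exact/ltW/f_star_gt0.
- exact: f_star_measurable.
- move=> A mA; have [x Cx xE] := theta_star_par.
  by rewrite /P_star /f_star -xE; exact: f_density.
Qed.

Lemma loss_measurable k x : coord_set M k x -> measurable_fun setT (loss k x).
Proof.
move=> Cx; apply: measurable_funB.
- by apply: measurableT_comp f_star_measurable; exact: measurable_ln.
- by apply: measurableT_comp (f_measurable M Cx); exact: measurable_ln.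
Qed.

Lemma expRN_loss k x z : coord_set M k x ->
  expR (- loss k x z) = fdens M (par M k x) z / f_star M z.
Proof.
move=> Cx; rewrite /loss opprB expRB !lnK// posrE; first exact: f_star_gt0.
exact: f_gt0.
Qed.

Lemma integral_expRN_loss k x A : coord_set M k x -> measurable A ->
  (\int[P_star M]_(z in A) (expR (- loss k x z))%:E = Pdist M (par M k x) A)%E.
Proof.
move=> Cx mA; rewrite integral_mkcond integral_P_star; last 2 first.
- by move=> z; apply: erestrict_ge0 => ? _; rewrite lee_fin expR_ge0.
- apply/(measurable_restrictT _ _).1 => //; apply: measurable_funTS.
  apply/measurable_EFinP; apply: measurableT_comp => //.
  by apply: measurable_funN; exact: loss_measurable.
rewrite (f_density M Cx mA) [RHS]integral_mkcond.
apply: eq_integral => z _; rewrite /patch; case: ifP => _; last by rewrite mul0e.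
by rewrite -EFinM expRN_loss// divfK// gt_eqF// f_star_gt0.
Qed.

Lemma integral_expRN_loss1 k x : coord_set M k x ->
  (\int[P_star M]_z (expR (- loss k x z))%:E = 1)%E.
Proof. by move=> Cx; rewrite integral_expRN_loss//; exact: probability_setT. Qed.

Lemma KL_ge0 k x : coord_set M k x -> (0 <= KL M (par M k x))%E.
Proof.
move=> Cx; apply: integral_expRN_ge0; first exact: loss_measurable.
exact: integral_expRN_loss1.
Qed.

Lemma KL_eq0_law k x A : coord_set M k x -> KL M (par M k x) = 0%E ->
  measurable A -> Pdist M (par M k x) A = P_star M A.
Proof.
move=> Cx K0 mA; rewrite -integral_expRN_loss//.
have ml := loss_measurable _ _ Cx.
have h := integral_expRN_eq0 _ _ _ _ _ ml (integral_expRN_loss1 _ _ Cx) K0.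
rewrite (ae_eq_integral (cst 1%E))//.
- by rewrite integral_cst// mul1e.
- apply: measurable_funTS; apply/measurable_EFinP; apply: measurableT_comp => //.
  exact: measurable_funN.
- by apply: filterS h => z /(_ Logic.I) hz _.
Qed.

(** Going down from [k] until [theta] is no longer in the preceding set, the level reached is
    [k_star M] by uniqueness of the order. The descent stops because [Theta M 0] is empty. *)
Lemma order_min k theta : (1 <= k)%N -> Theta M k theta ->
  (forall A, measurable A -> Pdist M theta A = Pdist M (theta_star M) A) ->
  (k_star M <= k)%N.
Proof.
case: k => // k _; elim: k theta => [|k IH] theta thk hth.
  rewrite (order_unique M 1 theta)//; split => //= -[x].
  by rewrite coord_set0.
have [thk'|nthk] := pselect (Theta M k.+1 theta); first exact/leqW/(IH theta).
by rewrite (order_unique M k.+2 theta).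
Qed.

(** A zero divergence would give the true law to a parameter of a level below [k_star M], which
    [order_min] excludes. *)
Lemma KL_gt0 k x : (1 <= k < k_star M)%N -> coord_set M k x ->
  (0 < KL M (par M k x))%E.
Proof.
move=> /andP[k1 kk] Cx; rewrite lt_neqAle KL_ge0// andbT eq_sym.
apply/negP => /eqP K0; move: kk; rewrite ltnNge => /negP; apply.
apply: (order_min _ (par M k x)) => //; first by exists x.
by move=> A mA; exact: KL_eq0_law.
Qed.

Lemma H_star_ge0 k : (0 <= H_star M k)%E.
Proof. by apply: le_ereal_inf_tmp => _ [_ [x Cx <-] <-]; exact: KL_ge0. Qed.

Lemma H_star_k_star : (H_star M (k_star M) <= 0)%E.
Proof.
apply: ge_ereal_inf; have [x Cx xE] := theta_star_par.
exists (KL M (theta_star M)); first by exists (theta_star M) => //; exists x.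
by rewrite /KL /f_star; under eq_integral do rewrite subrr; rewrite integral0.
Qed.

(** * Upper brackets around a fixed parameter *)

Section brackets.
Variables (k : nat) (x : 'rV[R]_(Defs.dim M k)).
Hypothesis k_gt0 : (1 <= k)%N.
Hypothesis Cx : coord_set M k x.
Let C := coord_set M k.
Let F y z := fdens M (par M k y) z.

(** Stated for [expR (ln (F y z))], continuous as a composition; it equals [F y z] on [C], where the
    density is known to be positive. *)
Let F_continuous z : {within C, continuous (fun y => expR (ln (F y z)))}.
Proof.
move=> y; apply: (@continuous_comp _ _ _ (fun y : subspace C => ln (F y z)) expR).
  exact: logf_continuous.
exact: continuous_expR.
Qed.

Let FE y z : C y -> expR (ln (F y z)) = F y z.
Proof. by move=> Cy; rewrite lnK// posrE; exact: f_gt0. Qed.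

Let F_near y z (e : R) : C y -> 0 < e ->
  exists2 r : R, 0 < r & forall y', C y' -> ball y r y' -> `|F y z - F y' z| < e.
Proof.
move=> Cy e0; have [r r0 h] := within_continuous_ball e (F_continuous z) Cy e0.
by exists r => // y' Cy' yy'; have := h _ Cy' yy'; rewrite !FE.
Qed.

Lemma fdens_has_sup (e : R) z : 0 < e ->
  has_sup [set fdens M (par M k y) z | y in eball M k x e].
Proof.
move=> e0; split.
  by exists (F x z), x => //; split => //; rewrite edistxx.
have /compact_bounded[B [_ hB]] := continuous_compact (F_continuous z)
  (coord_set_compact M k_gt0).
exists (B + 1) => _ [y [Cy _] <-].
have /hB : B < B + 1 by rewrite ltrDl.
move=> /(_ (expR (ln (F y z)))) h; rewrite (le_trans (ler_norm _))//.
by rewrite -[X in `|X|]FE//; apply: h; exists y.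
Qed.

Lemma fdens_le_upper (e : R) y z : C y -> edist x y < e ->
  fdens M (par M k y) z <= upper M k x e z.
Proof.
move=> Cy xy; apply: ub_le_sup; last by exists y.
apply: (fdens_has_sup _ _ _).2; apply: le_lt_trans xy.
by rewrite /Defs.edist sqrtr_ge0.
Qed.

Lemma upper_gt0 (e : R) z : 0 < e -> 0 < upper M k x e z.
Proof.
move=> e0; apply: (@lt_le_trans _ _ (F x z)); first exact: f_gt0.
by apply: fdens_le_upper => //; rewrite edistxx.
Qed.

Lemma upper_le (e e' : R) z : 0 < e -> e <= e' -> upper M k x e z <= upper M k x e' z.
Proof.
move=> e0 ee'; apply: ge_sup; first exact: (fdens_has_sup _ _ e0).1.
move=> _ [y [Cy xy] <-]; apply: fdens_le_upper => //; exact: lt_le_trans ee'.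
Qed.

(** The supremum runs over an uncountable ball. By continuity in the parameter and openness of the
    ball, it exceeds [c] iff the density does at some point of a dense sequence of [C] lying in the
    ball. *)
Lemma upper_measurable (e : R) : 0 < e -> measurable_fun setT (upper M k x e).
Proof.
move=> e0; have [u uC du] : exists2 u : nat -> 'rV[R]_(Defs.dim M k), (forall j, C (u j)) &
    (forall y (r : R), C y -> 0 < r -> exists j, ball (u j) r y).
  by apply: dense_sequence; exists x.
move=> _; apply: (measurability _ (RGenOInfty.measurableE R)) => //.
move=> _ [_ [c ->] <-]; rewrite setTI.
rewrite (_ : _ @^-1` _ = \bigcup_(j in [set j | edist x (u j) < e])
    (F (u j) @^-1` `]c, +oo[)).
  apply: bigcup_measurable => j _; rewrite -[X in measurable X]setTI.
  by apply: f_measurable => //; exact: uC.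
apply/seteqP; split => z /=; rewrite in_itv/= andbT.
- move=> /(sup_gt (fdens_has_sup _ _ e0).1)[_ [y [Cy xy] <-] cy].
  have cy0 : 0 < F y z - c by rewrite subr_gt0.
  have [r r0 hr] := F_near _ z _ Cy cy0.
  have /nbhs_ballP[r' /= r'0 hr'] : nbhs y [set y' | edist x y' < e].
    by apply: open_nbhs_nbhs; split => //; exact: open_edist_ball.
  have m0 : 0 < Num.min r r' by rewrite lt_min r0.
  have [j /ball_sym hj] := du _ _ Cy m0.
  exists j => /=.
    by apply: hr'; apply: le_ball hj; rewrite ge_min lexx orbT.
  rewrite in_itv/= andbT.
  have : `|F y z - F (u j) z| < F y z - c.
    by apply: hr => //; apply: le_ball hj; rewrite ge_min lexx.
  by move=> /(le_lt_trans (ler_norm _)); rewrite ltrD2l ltrN2.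
- move=> [j /= xj]; rewrite in_itv/= andbT => /lt_le_trans; apply.
  exact: fdens_le_upper.
Qed.

Lemma upper_cvg (eta : R) z : 0 < eta ->
  (fun m => upper M k x (eta / m.+1%:R) z) @ \oo --> fdens M (par M k x) z.
Proof.
move=> eta0; apply/cvgrPdist_le => e e0.
have [r r0 hr] := F_near _ z _ Cx e0.
exists (Num.truncn (eta / r)) => // m /= rm.
have m0 : 0 < (m.+1%:R : R) by rewrite ltr0n.
have em : eta / m.+1%:R <= r.
  rewrite ler_pdivrMr// mulrC -ler_pdivrMr//; apply/ltW.
  by apply: lt_le_trans (truncnS_gt _) _; rewrite ler_nat ltnS.
have em0 : 0 < eta / m.+1%:R by rewrite divr_gt0.
have h1 : F x z <= upper M k x (eta / m.+1%:R) z.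
  by apply: fdens_le_upper => //; rewrite edistxx.
have h2 : upper M k x (eta / m.+1%:R) z <= F x z + e.
  apply: ge_sup; first exact: (fdens_has_sup _ _ em0).1.
  move=> _ [y [Cy xy] <-].
  have : `|F x z - F y z| < e.
    by apply: hr => //; apply: edist_ball; exact: lt_le_trans em.
  by rewrite ltr_norml -/(F y z) => /andP[]; lra.
by rewrite -/(F x z) ler_norml; apply/andP; split; lra.
Qed.

(** With [u] the bracket, [p] the true density and [r = ln u - ln p], either [r <= 1] and
    [u <= expR 1 * p], or [u <= u * r ^+ 2]; both bounds have finite integrals. *)
Lemma integral_upper_lty (eta : R) : 0 < eta ->
  (Vdiv (mu := mu) (upper M k x eta) (f_star M) < +oo)%E ->
  (\int[mu]_z (upper M k x eta z)%:E < +oo)%E.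
Proof.
move=> eta0 Voo.
have mu1 : (\int[mu]_z (f_star M z)%:E = 1)%E.
  rewrite -(integral1_probability (P_star M)) integral_P_star//.
  by under [RHS]eq_integral do rewrite mul1e.
have mU := upper_measurable _ eta0; have mf := f_star_measurable.
have mUf : measurable_fun setT
    (fun z => upper M k x eta z * (ln (upper M k x eta z) - ln (f_star M z)) ^+ 2).
  apply: measurable_funM => //; apply: measurable_funX; apply: measurable_funB.
    by apply: measurableT_comp mU; exact: measurable_ln.
  by apply: measurableT_comp mf; exact: measurable_ln.
have U0 z := upper_gt0 _ z eta0; have f0 := f_star_gt0.
apply: (@le_lt_trans _ _ (\int[mu]_z ((upper M k x eta z *
   (ln (upper M k x eta z) - ln (f_star M z)) ^+ 2)%:E +
   (expR 1)%:E * (f_star M z)%:E))%E).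
  apply: ge0_le_integral => //.
  - by move=> z _; rewrite lee_fin ltW.
  - exact/measurable_EFinP.
  - apply: emeasurable_funD; first exact/measurable_EFinP.
    by apply: emeasurable_funM => //; exact/measurable_EFinP.
  - move=> z _; rewrite -EFinM -EFinD lee_fin.
    have u0 := U0 z; have fz0 := f0 z.
    set r := ln _ - ln _.
    have [r1|r1] := leP r 1.
      apply: (@le_trans _ _ (expR 1 * f_star M z)); last first.
        by rewrite lerDr mulr_ge0 ?sqr_ge0 ?ltW.
      rewrite -[leLHS]lnK ?posrE// -[X in _ * X]lnK ?posrE// -expRD ler_expR.
      by rewrite -lerBlDr.
    apply: (@le_trans _ _ (upper M k x eta z * r ^+ 2)); last first.
      by rewrite lerDl mulr_ge0 ?expR_ge0 ?(ltW fz0).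
    by rewrite -[leLHS]mulr1; apply: ler_wpM2l; [exact: ltW|rewrite expr2; nra].
rewrite ge0_integralD//; last 4 first.
- by move=> z _; rewrite lee_fin mulr_ge0 ?sqr_ge0// ltW.
- exact/measurable_EFinP.
- by move=> z _; rewrite mule_ge0// lee_fin ?expR_ge0// ltW.
- by apply: emeasurable_funM => //; exact/measurable_EFinP.
rewrite lte_add_pinfty// ge0_integralZl//.
- by rewrite mu1 mule1 ltry.
- exact/measurable_EFinP.
- by move=> z _; rewrite lee_fin ltW.
Qed.

(** Apply [decreasing_exponents_cvg] to the log-ratios [v m] of the brackets of radius
    [eta / m.+1%:R] to the truth, which decrease to [- loss k x]; radius and exponent vanish along
    the same index [m]. *)
Lemma KL_bracket (eta b : R) : 0 < eta ->
  (Vdiv (mu := mu) (upper M k x eta) (f_star M) < +oo)%E ->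
  (b%:E < KL M (par M k x))%E ->
  exists s delta h : R, exists v : Z -> R,
    [/\ [/\ 0 < s, 0 < delta & b < h], measurable_fun setT v,
      (forall y z, coord_set M k y -> edist x y < delta -> - loss k y z <= v z) &
      (\int[P_star M]_z (expR (s * v z))%:E <= (expR (- (s * h)))%:E)%E].
Proof.
move=> eta0 Voo bK.
(* The divergence may be [+oo], in which case any real above [b] will do. *)
have [h bh hK] : exists2 h, b < h & (h%:E < KL M (par M k x))%E.
  move: bK; case: (KL M _) => [r| |]//; rewrite ?lte_fin => br.
    by exists ((b + r) / 2); rewrite ?lte_fin; lra.
  by exists (b + 1); rewrite ?ltrDl ?ltry.
pose e m : R := eta / m.+1%:R.
have e0 m : 0 < e m by rewrite divr_gt0// ltr0n.
pose v m z := ln (upper M k x (e m) z) - ln (f_star M z).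
have mv m : measurable_fun setT (v m).
  apply: measurable_funB.
    by apply: measurableT_comp (upper_measurable _ (e0 m)); exact: measurable_ln.
  by apply: measurableT_comp f_star_measurable; exact: measurable_ln.
have mw : measurable_fun setT (fun z => - loss k x z).
  by apply: measurable_funN; exact: loss_measurable.
have vS m z : v m.+1 z <= v m z.
  rewrite lerD2r ler_ln ?posrE ?upper_gt0//; apply: upper_le => //.
  by rewrite ler_pM2l// lef_pV2 ?posrE ?ltr0n// ler_nat.
have vw z : v ^~ z @ \oo --> - loss k x z.
  rewrite /loss opprB; apply: cvgB; last exact: cvg_cst.
  apply: continuous_cvg; last exact: upper_cvg.
  by apply: continuous_ln; exact: f_gt0.
(* At [m = 0] the radius is [eta] and the exponent 1, so the moment is the [mu]-integral of the
   bracket. *)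
have v0oo : (\int[P_star M]_z (expR (v 0%N z))%:E < +oo)%E.
  rewrite integral_P_star//; last by apply/measurable_EFinP; exact: measurableT_comp.
  rewrite (eq_integral (fun z => (upper M k x eta z)%:E)).
    exact: integral_upper_lty.
  move=> z _; rewrite -EFinM; congr EFin.
  rewrite /v expRB !lnK ?posrE ?upper_gt0 ?f_star_gt0//.
  by rewrite divfK ?gt_eqF ?f_star_gt0// /e divr1.
have [|m hm] := decreasing_exponents_cvg _ _ _ (P_star M) v
    (fun z => - loss k x z) mv mw vS vw v0oo h.
  by under eq_integral do rewrite opprK.
exists (2^-1 ^+ m), (e m), h, (v m); split => //.
move=> y z Cy xy; rewrite /loss opprB lerD2r ler_ln ?posrE ?upper_gt0//.
  exact: fdens_le_upper.
exact: f_gt0.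
Qed.

End brackets.

(** On [Sset] the mean loss is at most [H_star + delta / 2]. Both terms of [qmoment] are second
    moments of the loss under the truth, the first one exponentially weighted, once [Vdiv] is
    rewritten by [integral_P_star]. *)
Lemma Sset_loss_moment k (alpha delta B b s : R) x : (1 <= k)%N -> coord_set M k x ->
  Sset M k delta (par M k x) -> (qmoment M (par M k x) alpha <= B%:E)%E ->
  0 <= B -> (H_star M k + (delta / 2)%:E <= b%:E)%E -> 0 <= s <= alpha ->
  (\int[P_star M]_z (expR (s * loss k x z))%:E <=
    (expR (s * (b + 2 * s * B)))%:E)%E.
Proof.
move=> k1 Cx [_ Sx] qB B0 Hb sa.
apply: (integral_expR_le _ _ _ _ _ alpha) => //; first exact: loss_measurable.
  exact: le_trans Hb.
apply: le_trans qB; rewrite /qmoment leeD2l// /Vdiv integral_P_star.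
- by under eq_integral do rewrite -EFinM mulrC.
- by move=> z; rewrite lee_fin sqr_ge0.
- apply/measurable_EFinP; apply: measurable_funX; exact: loss_measurable.
Qed.

End likelihood_ratio.

(** * Posterior probabilities *)

#[local] Arguments dens_measurable {R d Z mu} _ {k}.
#[local] Arguments dens_ge0 {R d Z mu} _ {k x}.
#[local] Arguments dens_int1 {R d Z mu} _ {k}.
#[local] Arguments weight_ge0 {R d Z mu} _ {k}.
#[local] Arguments weight_sum1 {R d Z mu} _.

Lemma expe1n {R : realType} n : (1 ^+ n = 1 :> \bar R)%E.
Proof. by elim: n => // n IH; rewrite expeS IH mul1e. Qed.

Lemma eseries_from1 {R : realType} (f : nat -> \bar R) :
  (\sum_(1 <= k <oo) f k = \sum_(k <oo) (if (1 <= k)%N then f k else 0))%E.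
Proof. by rewrite eseries_cond eseries_mkcond. Qed.

Section posterior.
Context {R : realType} {d : measure_display} {Z : measurableType d}
  {mu : {measure set Z -> \bar R}} (M : bayes_model mu).
Local Notation param k := ((Defs.dim M k).-tuple (measurableTypeR R)).
Local Notation leb k := (lebesgue_pow R (Defs.dim M k)).

Definition coord_tuples k : set (param k) := [set t | coord_set M k (to_row t)].

(* Extension by [0] of the log-likelihood ratio outside the parameter set, so that
   Tonelli's theorem applies on a full product space. *)
Definition loss0 k (t : param k) (z : Z) : R :=
  if t \in coord_tuples k then loss M k (to_row t) z else 0.

Definition loss_sum k n (t : param k) (z : n.-tuple Z) : R :=
  \sum_(i < n) loss0 k t (tnth z i).

Definition prior_dens0 k (t : param k) : R :=
  if t \in coord_tuples k then prior_dens M k (to_row t) else 0.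

(** Marginal likelihood divided by the true product density at the sample, a factor common to all
    [k] (see [marginal_ratioE]). *)
Definition marginal_ratio k n (z : n.-tuple Z) : \bar R :=
  (\int[leb k]_t (expR (- loss_sum k n t z) * prior_dens0 k t)%:E)%E.

Lemma coord_tuples_measurable k : (1 <= k)%N -> measurable (coord_tuples k).
Proof.
move=> k1; apply: to_row_preimage_measurable.
by apply: compact_closed => //; exact: coord_set_compact.
Qed.

Lemma loss0_measurable k : (1 <= k)%N ->
  measurable_fun setT (fun p : param k * Z => loss0 k p.1 p.2).
Proof.
move=> k1.
have cC : closed (coord_set M k).
  by apply: compact_closed => //; exact: coord_set_compact.
rewrite (_ : (fun=> _) = (fun p : param k * Z => loss M k (to_row p.1) p.2) \_
    [set p | coord_set M k (to_row p.1)]); last first.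
  apply/funext => p; rewrite /loss0 /patch.
  by congr (if _ then _ else _); apply/idP/idP; rewrite !inE.
apply/(measurable_restrictT _ _).1.
  rewrite (_ : mkset _ = coord_tuples k `*` setT); last first.
    by apply/seteqP; split => p //= [].
  by apply: measurableX => //; exact: coord_tuples_measurable.
apply: (within_continuous_measurable_prod _ _ _ (fun x z => loss M k x z)) => //.
- move=> z; rewrite /loss => x.
  by apply: cvgB; [exact: cvg_cst|exact: logf_continuous].
- by move=> x Cx; exact: loss_measurable.
Qed.

Lemma loss_sum_measurable k n : (1 <= k)%N ->
  measurable_fun setT (fun p : param k * n.-tuple Z => loss_sum k n p.1 p.2).
Proof.
move=> k1; apply: measurable_sum => i.
apply: (measurableT_comp (loss0_measurable _ k1)
  (g := fun p : param k * n.-tuple Z => (p.1, tnth p.2 i))).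
apply/measurable_fun_pair => //.
exact: (measurableT_comp (measurable_tnth i) measurable_snd).
Qed.

Lemma loss_sum_measurable_l k n z : (1 <= k)%N ->
  measurable_fun setT (fun t => loss_sum k n t z).
Proof.
move=> k1; apply: (measurableT_comp (loss_sum_measurable _ n k1)
  (g := fun t => (t, z))).
exact/measurable_fun_pair.
Qed.

Lemma loss0_measurable_r k t : measurable_fun setT (loss0 k t).
Proof.
rewrite (_ : loss0 k t = if t \in coord_tuples k
    then loss M k (to_row t) else cst 0); last first.
  by apply/funext => z; rewrite /loss0; case: ifP.
case: ifPn => [|_]; last exact: measurable_cst.
by rewrite inE => Ct; exact: loss_measurable.
Qed.

Lemma prior_dens0_measurable k : (1 <= k)%N -> measurable_fun setT (prior_dens0 k).
Proof.
move=> k1.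
rewrite (_ : prior_dens0 k = (fun t => prior_dens M k (to_row t)) \_ (coord_tuples k))//.
apply/(measurable_restrictT _ _).1; first exact: coord_tuples_measurable.
exact: dens_measurable.
Qed.

Lemma prior_dens0_ge0 k t : (1 <= k)%N -> 0 <= prior_dens0 k t.
Proof.
by move=> k1; rewrite /prior_dens0; case: ifPn => //; rewrite inE; exact: dens_ge0.
Qed.

Lemma integral_prior_dens0 k : (1 <= k)%N ->
  (\int[leb k]_t (prior_dens0 k t)%:E = 1)%E.
Proof.
move=> k1; rewrite -(dens_int1 M k1) [RHS]integral_mkcond.
by apply: eq_integral => t _; rewrite /prior_dens0 /patch; case: ifP.
Qed.

Lemma f_star_prod_gt0 n (z : n.-tuple Z) : 0 < \prod_(i < n) f_star M (tnth z i).
Proof. by apply: prodr_gt0 => i _; exact: f_star_gt0. Qed.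

Lemma f_star_prod_measurable n :
  measurable_fun setT (fun z : n.-tuple Z => \prod_(i < n) f_star M (tnth z i)).
Proof.
apply: measurable_prod => i _.
exact: (measurableT_comp (f_star_measurable M) (measurable_tnth i)).
Qed.

Lemma marginal_ratioE k n z : (1 <= k)%N -> (marginal M k n z =
  (\prod_(i < n) f_star M (tnth z i))%:E * marginal_ratio k n z)%E.
Proof.
move=> k1; rewrite /marginal integral_mkcond -ge0_integralZl//; last 3 first.
- apply/measurable_EFinP; apply: measurable_funM; last exact: prior_dens0_measurable.
  by apply: measurableT_comp => //; apply: measurable_funN; exact: loss_sum_measurable_l.
- by move=> t _; rewrite lee_fin mulr_ge0 ?expR_ge0// prior_dens0_ge0.
- by rewrite lee_fin ltW// f_star_prod_gt0.
apply: eq_integral => t _; rewrite -EFinM /patch -[_ @^-1` _]/(coord_tuples k).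
rewrite /prior_dens0; case: ifPn => tC; last by rewrite !mulr0.
  rewrite mulrA; congr (_ * _)%:E.
  rewrite /loss_sum -sumrN expR_sum -big_split/=; apply: eq_bigr => i _.
  rewrite /loss0 tC expRN_loss; last by move: tC; rewrite inE.
  by rewrite mulrC divfK// gt_eqF// f_star_gt0.
Qed.

Let joint_measurable k n : (1 <= k)%N -> measurable_fun setT
  (fun p : param k * n.-tuple Z =>
     (expR (- loss_sum k n p.1 p.2) * prior_dens0 k p.1)%:E).
Proof.
move=> k1; apply/measurable_EFinP; apply: measurable_funM.
  by apply: measurableT_comp => //; apply: measurable_funN; exact: loss_sum_measurable.
exact: (measurableT_comp (prior_dens0_measurable _ k1) measurable_fst).
Qed.

Let joint_ge0 k n (p : param k * n.-tuple Z) : (1 <= k)%N ->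
  (0 <= (expR (- loss_sum k n p.1 p.2) * prior_dens0 k p.1)%:E)%E.
Proof. by move=> k1; rewrite lee_fin mulr_ge0 ?expR_ge0// prior_dens0_ge0. Qed.

Lemma marginal_ratio_ge0 k n z : (1 <= k)%N -> (0 <= marginal_ratio k n z)%E.
Proof. by move=> k1; apply: integral_ge0 => t _; exact: (joint_ge0 k n (t, z)). Qed.

Lemma marginal_ratio_measurable k n : (1 <= k)%N ->
  measurable_fun setT (marginal_ratio k n).
Proof.
move=> k1; apply: (measurable_fun_fubini_tonelli_G (m1 := leb k)
  (fun p : param k * n.-tuple Z =>
     (expR (- loss_sum k n p.1 p.2) * prior_dens0 k p.1)%:E)).
  exact: joint_measurable.
by move=> p; exact: joint_ge0.
Qed.

Lemma integral_expR_loss_sum k n t (c : R) :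
  (\int[P_star_pow M n]_z (expR (c * loss_sum k n t z))%:E =
   (\int[P_star M]_z (expR (c * loss0 k t z))%:E) ^+ n)%E.
Proof.
rewrite -integral_power_expR; last first.
  by apply: measurable_funM => //; exact: loss0_measurable_r.
by apply: eq_integral => z _; rewrite /loss_sum mulr_sumr.
Qed.

(** Tonelli's theorem: each likelihood ratio has mean 1 under the truth, and the prior density has
    integral 1. *)
Lemma integral_marginal_ratio k n : (1 <= k)%N ->
  (\int[P_star_pow M n]_z marginal_ratio k n z = 1)%E.
Proof.
move=> k1.
rewrite -(fubini_tonelli (fun p : param k * n.-tuple Z =>
     (expR (- loss_sum k n p.1 p.2) * prior_dens0 k p.1)%:E)); last 2 first.
- exact: joint_measurable.
- by move=> p; exact: joint_ge0.
rewrite -[RHS](integral_prior_dens0 _ k1); apply: eq_integral => t _ /=.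
under eq_integral do rewrite mulrC EFinM.
rewrite ge0_integralZl ?lee_fin ?prior_dens0_ge0//; last first.
  apply/measurable_EFinP; apply: measurableT_comp => //; apply: measurable_funN.
  apply: (measurableT_comp (loss_sum_measurable _ n k1) (g := fun z => (t, z))).
  exact/measurable_fun_pair.
under eq_integral do rewrite -mulN1r.
rewrite integral_expR_loss_sum.
rewrite (_ : integral _ _ _ = 1%E); first by rewrite expe1n mule1.
under eq_integral do rewrite mulN1r.
(* Outside the parameter set [loss0] is 0, which gives mean 1 as well. *)
rewrite /loss0; have [|_] := boolP (t \in _).
  by rewrite inE => Ct; exact: integral_expRN_loss1.
by under eq_integral do rewrite oppr0 expR0; exact: integral1_probability.
Qed.

Lemma marginal_measurable k n : (1 <= k)%N -> measurable_fun setT (marginal M k n).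
Proof.
move=> k1; rewrite (_ : marginal M k n = fun z =>
    ((\prod_(i < n) f_star M (tnth z i))%:E * marginal_ratio k n z)%E).
  apply: emeasurable_funM; last exact: marginal_ratio_measurable.
  by apply/measurable_EFinP; exact: f_star_prod_measurable.
by apply/funext => z; exact: marginal_ratioE.
Qed.

Lemma marginal_ge0 k n z : (1 <= k)%N -> (0 <= marginal M k n z)%E.
Proof.
move=> k1; rewrite marginal_ratioE// mule_ge0 ?marginal_ratio_ge0//.
by rewrite lee_fin ltW// f_star_prod_gt0.
Qed.

Let weighted_ge0 k n z : (1 <= k)%N -> (0 <= (weight M k)%:E * marginal M k n z)%E.
Proof. by move=> k1; rewrite mule_ge0 ?marginal_ge0// lee_fin weight_ge0. Qed.

Lemma evidence_ge0 n z : (0 <= evidence M n z)%E.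
Proof. by apply: nneseries_ge0 => k k1 _; exact: weighted_ge0. Qed.

Lemma weighted_le_evidence k n z : (1 <= k)%N ->
  ((weight M k)%:E * marginal M k n z <= evidence M n z)%E.
Proof.
move=> k1; rewrite /evidence.
apply: (@le_trans _ _ (\sum_(1 <= j < k.+1) (weight M j)%:E * marginal M j n z)%E);
  last by apply: nneseries_lim_ge => j j1 _; exact: weighted_ge0.
rewrite big_nat_recr//=; apply: leeDr.
by rewrite big_nat; apply: sume_ge0 => j /andP[j1 _]; exact: weighted_ge0.
Qed.

Lemma evidence_measurable n : measurable_fun setT (evidence M n).
Proof.
rewrite (_ : evidence M n = fun z => (\sum_(k <oo | k \in xpredT)
    (if (1 <= k)%N then (weight M k)%:E * marginal M k n z else 0))%E); last first.
  by apply/funext => z; rewrite /evidence eseries_from1.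
apply: ge0_emeasurable_sum => k.
- by move=> z _ _; case: ifP => // k1; exact: weighted_ge0.
- move=> _; have [k1|_] := boolP (1 <= k)%N; last exact: measurable_cst.
  by apply: emeasurable_funM => //; exact: marginal_measurable.
Qed.

Definition evidence_infinite n := [set z : n.-tuple Z | evidence M n z = +oo%E].

Lemma evidence_infinite_measurable n : measurable (evidence_infinite n).
Proof.
rewrite (_ : evidence_infinite n = evidence M n @^-1` [set +oo%E])//.
by rewrite -[X in measurable X]setTI; apply: evidence_measurable.
Qed.

(** Relative to the true product density, the evidence is the average of the marginal ratios with
    weights [weight M k]. Its expectation is thus the total weight 1, and it is almost surely
    finite. *)
Lemma evidence_infinite_null n : P_star_pow M n (evidence_infinite n) = 0%E.
Proof.
pose g k (z : n.-tuple Z) : \bar R :=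
  (if (1 <= k)%N then (weight M k)%:E * marginal_ratio k n z else 0)%E.
have g0 k z : (0 <= g k z)%E.
  rewrite /g; case: ifP => // k1.
  by rewrite mule_ge0 ?marginal_ratio_ge0// lee_fin weight_ge0.
have mg k : measurable_fun setT (g k).
  rewrite /g; have [k1|_] := boolP (1 <= k)%N; last exact: measurable_cst.
  by apply: emeasurable_funM => //; exact: marginal_ratio_measurable.
have evE z : evidence M n z =
    ((\prod_(i < n) f_star M (tnth z i))%:E * \sum_(k <oo) g k z)%E.
  rewrite /evidence eseries_from1 -nneseriesZl//; apply: eq_eseriesr => k _.
  rewrite /g; case: ifP => k1; last by rewrite mule0.
  by rewrite marginal_ratioE// muleCA.
have int1 : (\int[P_star_pow M n]_z (\sum_(k <oo) g k z) = 1)%E.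
  rewrite integral_nneseries// -(weight_sum1 M) [RHS]eseries_from1.
  apply: eq_eseriesr => k _; rewrite /g; case: ifP => k1; last by rewrite integral0.
  rewrite ge0_integralZl//.
  - by rewrite integral_marginal_ratio// mule1.
  - exact: marginal_ratio_measurable.
  - by move=> z _; exact: marginal_ratio_ge0.
  - by rewrite lee_fin weight_ge0.
have mG : measurable_fun setT (fun z => \sum_(k <oo) g k z)%E.
  rewrite (_ : (fun=> _) = fun z => (\sum_(k <oo | k \in xpredT) g k z)%E)//.
  by apply: ge0_emeasurable_sum.
have G0 z : (0 <= \sum_(k <oo) g k z)%E by apply: nneseries_ge0.
have iG : (P_star_pow M n).-integrable setT (fun z => \sum_(k <oo) g k z)%E.
  apply/integrableP; split => //.
  by under eq_integral do rewrite gee0_abs//; rewrite int1 ltry.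
have [N [mN N0 hN]] := integrable_ae measurableT iG.
apply/eqP; rewrite eq_le measure_ge0 andbT -N0.
apply: le_measure; rewrite ?inE//; first exact: evidence_infinite_measurable.
move=> z; rewrite /evidence_infinite/= evE => zoo; apply: hN => /= /(_ Logic.I) fin.
by move: zoo; rewrite -(fineK fin) -EFinM.
Qed.

(** The evidence and the true product density are common factors and cancel, except that infinite
    evidence makes every posterior 0, so that the comparison holds trivially. *)
Lemma posterior_leP k k' n z : (1 <= k)%N -> (1 <= k')%N ->
  (posterior M k' n z <= posterior M k n z)%E <->
  evidence_infinite n z \/
  ((weight M k')%:E * marginal_ratio k' n z <= (weight M k)%:E * marginal_ratio k n z)%E.
Proof.
move=> k1 k'1.
have -> : ((weight M k')%:E * marginal_ratio k' n z <=
     (weight M k)%:E * marginal_ratio k n z)%E =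
   ((weight M k')%:E * marginal M k' n z <= (weight M k)%:E * marginal M k n z)%E.
  rewrite !marginal_ratioE// 2!(muleCA (weight M _)%:E) lee_pmul2l//.
  by rewrite lte_fin f_star_prod_gt0.
rewrite /posterior /evidence_infinite /=.
have := evidence_ge0 n z; have := weighted_le_evidence k n z k1.
have := weighted_le_evidence k' n z k'1.
have := weighted_ge0 k n z k1; have := weighted_ge0 k' n z k'1.
move: ((weight M k')%:E * marginal M k' n z)%E ((weight M k)%:E * marginal M k n z)%E.
move=> a b a0 b0; case: (evidence M n z) => [r ar br r0| |//]; last first.
  by rewrite invey !mule0 lexx; split => // _; left.
(* At zero evidence the inverse is [+oo], but both numerators vanish and [0 * +oo = 0]. *)
rewrite inver; case: eqP => [rE|/eqP r_neq0].
  rewrite {}rE in ar br.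
  have -> : a = 0%E by apply/eqP; rewrite eq_le ar.
  have -> : b = 0%E by apply/eqP; rewrite eq_le br.
  by rewrite !mul0e lexx; split => // _; right.
rewrite lee_pmul2r ?lte_fin ?invr_gt0 ?lt_neqAle 1?eq_sym ?r_neq0//.
by split => [|[]//]; right.
Qed.

Lemma posterior_le_measurable k k' n : (1 <= k)%N -> (1 <= k')%N ->
  measurable [set z | (posterior M k' n z <= posterior M k n z)%E].
Proof.
move=> k1 k'1.
rewrite (_ : mkset _ = evidence_infinite n `|` [set z |
    ((weight M k')%:E * marginal_ratio k' n z <= (weight M k)%:E * marginal_ratio k n z)%E]).
  apply: measurableU; first exact: evidence_infinite_measurable.
  rewrite -[X in measurable X]setTI.
  by apply: measurable_lee => //; apply: emeasurable_funM => //;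
    exact: marginal_ratio_measurable.
by apply/seteqP; split => z /= /posterior_leP; apply.
Qed.

End posterior.

(** * Exponential bounds *)

Section exponential_decay.
Context {R : realType}.
Implicit Types u v : nat -> \bar R.

Definition exp_decay u : Prop := exists c1 c2 : R, [/\ 0 < c1, 0 < c2 &
  forall n, (1 <= n)%N -> (u n <= (c1 * expR (- (n%:R * c2)))%:E)%E].

Lemma exp_decay_le u v : exp_decay v ->
  (forall n, (1 <= n)%N -> (u n <= v n)%E) -> exp_decay u.
Proof.
move=> [c1 [c2 [c10 c20 vle]]] uv; exists c1, c2; split => // n n1.
exact: le_trans (uv _ n1) (vle _ n1).
Qed.

Lemma exp_decayD u v : exp_decay u -> exp_decay v ->
  exp_decay (fun n => u n + v n)%E.
Proof.
move=> [a1 [a2 [a10 a20 ua]]] [b1 [b2 [b10 b20 vb]]].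
exists (a1 + b1), (Num.min a2 b2); split => [||n n1].
- exact: addr_gt0.
- by rewrite lt_min a20.
- rewrite mulrDl EFinD; apply: leeD.
    apply: le_trans (ua _ n1) _; rewrite lee_fin ler_pM2l// ler_expR lerN2.
    by rewrite ler_wpM2l// ge_min lexx.
  apply: le_trans (vb _ n1) _; rewrite lee_fin ler_pM2l// ler_expR lerN2.
  by rewrite ler_wpM2l// ge_min lexx orbT.
Qed.

Lemma exp_decay_sum (I : eqType) (s : seq I) (u : I -> nat -> \bar R) :
  (forall i, i \in s -> exp_decay (u i)) ->
  exp_decay (fun n => \sum_(i <- s) u i n)%E.
Proof.
elim: s => [|i s IH] us.
  exists 1, 1; split => // n _.
  by rewrite big_nil lee_fin mul1r expR_ge0.
apply: (@exp_decay_le _ (fun n => u i n + \sum_(j <- s) u j n)%E) => [|n _].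
  apply: exp_decayD; first by apply: us; rewrite mem_head.
  by apply: IH => j js; apply: us; rewrite inE js orbT.
by rewrite big_cons.
Qed.

Lemma exp_decay_expR (c r : R) : 0 < r ->
  exp_decay (fun n => (expR (c - n%:R * r))%:E).
Proof.
move=> r0; exists (expR c), r; split => //; first exact: expR_gt0.
by move=> n _; rewrite expRD.
Qed.

End exponential_decay.

(** Supplies a single threshold for all brackets of a finite cover, each with its own strict
    inequality. *)
Lemma dense_between_seq {R : realType} (I : eqType) (s : seq I) (h : I -> R) (a : R) :
  (forall i, i \in s -> a < h i) -> exists2 b, a < b & forall i, i \in s -> b < h i.
Proof.
elim: s => [|i s IH] ah; first by exists (a + 1); rewrite ?ltrDl.
have [|b ab bh] := IH; first by move=> j js; apply: ah; rewrite inE js orbT.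
have ai : a < h i by apply: ah; rewrite mem_head.
exists (Num.min b ((a + h i) / 2)).
  by rewrite lt_min ab/=; lra.
move=> j; rewrite inE => /predU1P[->|js]; last by rewrite gt_min bh.
by rewrite gt_min; apply/orP; right; lra.
Qed.

Lemma integral_markov d (T : measurableType d) (R : realType)
    (m : {measure set T -> \bar R}) (A : set T) (W : T -> \bar R) :
  measurable A -> measurable_fun setT W -> (forall x, (0 <= W x)%E) ->
  (forall x, A x -> (1 <= W x)%E) -> (m A <= \int[m]_x W x)%E.
Proof.
move=> mA mW W0 AW.
rewrite -[leLHS]mul1e -integral_cst//.
apply: (@le_trans _ _ (\int[m]_(x in A) W x)%E).
  by apply: ge0_le_integral => //; exact: measurable_funTS.
by apply: ge0_subset_integral.
Qed.

Lemma expe_le_expR {R : realType} (x : \bar R) (r : R) n :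
  (0 <= x -> x <= (expR r)%:E -> x ^+ n <= (expR (n%:R * r))%:E)%E.
Proof.
move=> x0 xr; elim: n => [|n IH]; first by rewrite expe0 mul0r expR0.
rewrite expeS -natr1 mulrDl mul1r addrC expRD EFinM.
by apply: lee_pmul => //; exact: expe_ge0.
Qed.

(** * Comparison of the posterior probabilities of two orders *)

Section underestimation.
Context {R : realType} {d : measure_display} {Z : measurableType d}
  {mu : {measure set Z -> \bar R}} (M : bayes_model mu).
Local Notation param k := ((Defs.dim M k).-tuple (measurableTypeR R)).
Local Notation leb k := (lebesgue_pow R (Defs.dim M k)).
Import HBNNSimple.

(** [B] may fail to be measurable, so the prior density restricted to [B] is replaced by a simple
    function below it. One with positive integral exists, since the integral is a supremum over such
    functions. *)
Lemma prior_nnsfun k (B : set (Defs.point M)) : (1 <= k)%N -> (0 < prior_prob M k B)%E ->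
  exists h : {nnsfun param k >-> R},
    [/\ (forall t, h t <= prior_dens0 M k t),
      (forall t, 0 < h t -> coord_set M k (to_row t) /\ B (par M k (to_row t))) &
      (0 < \int[leb k]_t (h t)%:E)%E].
Proof.
move=> k1; rewrite /prior_prob ge0_integralE; last first.
  by move=> t [Ct _]; rewrite lee_fin; exact: dens_ge0.
move=> /ereal_sup_gt[_ [h hle <-] h0]; exists h.
split; last by rewrite integralT_nnsfun.
- move=> t; have := hle t; rewrite /patch; case: ifPn => [|_].
    rewrite inE => -[Ct Bt]; rewrite lee_fin => /le_trans; apply.
    by rewrite /prior_dens0 ifT// inE.
  by rewrite lee_fin => /le_trans; apply; exact: prior_dens0_ge0.
- move=> t ht; have := hle t; rewrite /patch; case: ifPn => [|_].
    by rewrite inE.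
  by rewrite lee_fin leNgt ht.
Qed.

Lemma posterior_le_decay k k' : A1 M -> A2 M ->
  (1 <= k)%N -> 0 < weight M k -> (1 <= k')%N -> 0 < weight M k' ->
  (forall delta : R, 0 < delta -> (0 < prior_prob M k' (Sset M k' delta))%E) ->
  (forall x, coord_set M k x -> (H_star M k' < KL M (par M k x))%E) ->
  exp_decay (fun n => P_star_pow M n
    [set z | (posterior M k' n z <= posterior M k n z)%E]).
Proof.
move=> hA1 hA2 k1 wk k'1 wk' hprior hKL.
pose C := coord_set M k.
(* [C] is nonempty because the prior density integrates to 1 over it; [H_star M k'], strictly below
   the divergence at [x0], is therefore finite. *)
have [x0 Cx0] : exists x, C x.
  apply/set0P/eqP => C0; have := dens_int1 M k1.
  rewrite (_ : _ @^-1` _ = set0); last by rewrite -/C C0 preimage_set0.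
  by rewrite integral_set0 => /esym/eqP; rewrite onee_eq0.
have [b0 Hb0] : exists b0 : R, H_star M k' = b0%:E.
  exists (fine (H_star M k')); rewrite fineK// ge0_fin_numE; last exact: H_star_ge0.
  exact: lt_le_trans (hKL _ Cx0) (leey _).
(* [q] packs the exponent, radius, rate and dominating function of [KL_bracket]. Outside [C] a dummy
   value keeps the function measurable for every [x]. *)
have /choice[br hbr] : forall x, exists q : R * R * R * (Z -> R),
    measurable_fun setT q.2 /\ (C x ->
    [/\ [/\ 0 < q.1.1.1, 0 < q.1.1.2 & b0 < q.1.2],
      (forall y z, coord_set M k y -> edist x y < q.1.1.2 -> - loss M k y z <= q.2 z) &
      (\int[P_star M]_z (expR (q.1.1.1 * q.2 z))%:E <=
        (expR (- (q.1.1.1 * q.1.2)))%:E)%E]).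
  move=> x; have [Cx|nCx] := pselect (C x); last first.
    by exists (1, 1, 1, cst 1).
  have [eta eta0 hV] := hA2 k x k1 Cx.
  have V1 : (Vdiv (mu := mu) (upper M k x eta) (f_star M) < +oo)%E.
    have Vge0 g g' : (forall z, 0 <= g z) -> (0 <= Vdiv (mu := mu) g g')%E.
      by move=> g0; apply: integral_ge0 => z _; rewrite lee_fin mulr_ge0 ?sqr_ge0.
    have fs0 z : 0 <= f_star M z by rewrite ltW// f_star_gt0.
    have up0 z : 0 <= upper M k x eta z by rewrite ltW// upper_gt0.
    move: hV; have := Vge0 _ (f_star M) up0; have := Vge0 _ (lower M k x eta) fs0.
    have := Vge0 _ (upper M k x eta) fs0; have := Vge0 _ (fdens M (par M k x)) up0.
    by move: (Vdiv _ _) (Vdiv _ _) (Vdiv _ _) (Vdiv _ _) => [?| |] [?| |] [?| |] [?| |]; rewrite ?ltry.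
  have [|s [dl [h [v [H1 H2 H3 H4]]]]] := KL_bracket M k x k1 Cx eta b0 eta0 V1.
    by rewrite -Hb0; exact: hKL.
  by exists (s, dl, h, v).
pose sx x := (br x).1.1.1; pose dx x := (br x).1.1.2.
pose hx x := (br x).1.2; pose vx x := (br x).2.
have [xs xsC hxs] := edist_finite_cover dx (coord_set_compact M k1)
  (fun x Cx => let: And3 (And3 _ h _) _ _ := (hbr x).2 Cx in h).
have [b b0b bhx] : exists2 b, b0 < b & forall x, x \in xs -> b < hx x.
  by apply: dense_between_seq => x /xsC/(hbr x).2[[]].
have [al [dl0 [B [al0 dl00 B1 hB]]]] := hA1 k' k'1.
(* [dl / 2] and [2 * s * B] are each at most [(b - b0) / 4], so that together with [b0] they stay
   below the midpoint [b1] of [b0] and [b]. *)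
pose dl := Num.min dl0 ((b - b0) / 2).
have dl_gt0 : 0 < dl by rewrite lt_min dl00/=; lra.
pose s := Num.min al ((b - b0) / (8 * B)).
have s0 : 0 < s by rewrite lt_min al0/= divr_gt0//; lra.
pose b1 := (b0 + b) / 2.
have b1b : b1 < b by rewrite /b1; lra.
have sB : b0 + dl / 2 + 2 * s * B <= b1.
  have : dl <= (b - b0) / 2 by rewrite ge_min lexx orbT.
  have : s * (8 * B) <= b - b0.
    by rewrite -ler_pdivlMr; [rewrite ge_min lexx orbT|lra].
  by rewrite /b1; lra.
have [h [hrho hS h_int]] := prior_nnsfun k' _ k'1 (hprior _ dl_gt0).
have h0 t : 0 <= h t by [].
have mh : measurable_fun setT h by [].
have [w w0 wE] : exists2 w : R, 0 < w & (\int[leb k']_t (h t)%:E)%E = w%:E.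
  have hle1 : (\int[leb k']_t (h t)%:E <= 1)%E.
    rewrite -(integral_prior_dens0 M k' k'1); apply: ge0_le_integral => //.
    - by move=> t _; rewrite lee_fin.
    - exact/measurable_EFinP.
    - by apply/measurable_EFinP; exact: prior_dens0_measurable.
    - by move=> t _; rewrite lee_fin.
  move: h_int hle1; case: (integral _ _ _) => // w; rewrite lte_fin => w0 _.
  by exists w.
have hmom t : 0 < h t ->
    (\int[P_star M]_z (expR (s * loss0 M k' t z))%:E <= (expR (s * b1))%:E)%E.
  move=> /hS[Ct St].
  under eq_integral do rewrite /loss0 ifT ?inE//.
  apply: le_trans (Sset_loss_moment M k' al dl B (b0 + dl / 2) s _ k'1 Ct St _ _ _ _) _.
  - apply: le_trans (hB dl dl_gt0 _); last by rewrite ge_min lexx.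
    by apply: ereal_sup_ubound; exists (par M k' (to_row t)).
  - by lra.
  - by rewrite Hb0 -EFinD.
  - by rewrite ltW//= ge_min lexx.
  - by rewrite lee_fin ler_expR ler_pM2l.
(* Mean of the power [- s] of the likelihood ratio times [expR (n%:R * b)], under the probability
   density [h / w]. *)
pose A n z : \bar R :=
  (\int[leb k']_t (w^-1 * h t * expR (s * loss_sum M k' n t z - s * n%:R * b))%:E)%E.
(* Chosen so that [weight M k * (size xs).+1%:R * kap = weight M k' * w]: if all brackets are below
   [kap * expR (- (n%:R * b))], the weights cancel in [X_le]. The successor keeps the denominator
   positive. *)
pose kap := weight M k' * w / (weight M k * (size xs).+1%:R).
have kap0 : 0 < kap by rewrite divr_gt0// mulr_gt0// ltr0n.
pose V x n (z : n.-tuple Z) := \sum_(i < n) vx x (tnth z i).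
(* The power [sx x] of [expR (V x n z + n%:R * b) / kap], hence at least 1 when the bracket at [x]
   is large. *)
pose Bx x n z : \bar R := (expR (sx x * V x n z + (sx x * n%:R * b - sx x * ln kap)))%:E.
(* [W] is at least 1 on the event: either some bracket satisfies
   [kap * e^(-nb) <= e^V], or the integral [X] below is at most [w * e^(-nb)]. *)
pose W n z := (A n z + \sum_(x <- xs) Bx x n z)%E.
have A0 n z : (0 <= A n z)%E.
  apply: integral_ge0 => t _; rewrite lee_fin mulr_ge0 ?expR_ge0//.
  by rewrite mulr_ge0// invr_ge0 ltW.
have Bx0 x n z : (0 <= Bx x n z)%E by rewrite lee_fin expR_ge0.
have mAj n : measurable_fun setT (fun p : param k' * n.-tuple Z =>
    (w^-1 * h p.1 * expR (s * loss_sum M k' n p.1 p.2 - s * n%:R * b))%:E).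
  apply/measurable_EFinP; apply: measurable_funM.
    by apply: measurable_funM => //; exact: (measurableT_comp mh measurable_fst).
  apply: measurableT_comp => //; apply: measurable_funB => //.
  by apply: measurable_funM => //; exact: loss_sum_measurable.
have Aj0 n (p : param k' * n.-tuple Z) :
    (0 <= (w^-1 * h p.1 * expR (s * loss_sum M k' n p.1 p.2 - s * n%:R * b))%:E)%E.
  rewrite lee_fin mulr_ge0 ?expR_ge0//.
  by rewrite mulr_ge0// invr_ge0 ltW.
have mA n : measurable_fun setT (A n).
  exact: (measurable_fun_fubini_tonelli_G (m1 := leb k') _ (mAj n) (Aj0 n)).
have mvx x : measurable_fun setT (vx x) by have [] := hbr x.
have mV x n : measurable_fun setT (V x n) by exact: measurable_sum_tnth.
have mBx x n : measurable_fun setT (Bx x n).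
  apply/measurable_EFinP; apply: measurableT_comp => //.
  apply: measurable_funD; last exact: measurable_cst.
  exact: (measurable_funM (measurable_cst _) (mV x n)).
have intA n : (\int[P_star_pow M n]_z A n z <= (expR (0 - n%:R * (s * (b - b1))))%:E)%E.
  rewrite -(fubini_tonelli _ (mAj n) (Aj0 n)) /=.
  pose c := w^-1 * expR (0 - n%:R * (s * (b - b1))).
  have c0 : 0 <= c by rewrite mulr_ge0 ?expR_ge0// invr_ge0 ltW.
  apply: (@le_trans _ _ (\int[leb k']_t (c%:E * (h t)%:E))%E); last first.
    rewrite ge0_integralZl//.
    - by rewrite wE -EFinM /c mulrAC mulVf ?mul1r// gt_eqF.
    - exact/measurable_EFinP.
    - by move=> t _; rewrite lee_fin.
  apply: ge0_le_integral => //.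
  - by move=> t _; apply: integral_ge0 => z _; exact: (Aj0 n (t, z)).
  - exact: (measurable_fun_fubini_tonelli_F (m2 := P_star_pow M n) _ (mAj n) (Aj0 n)).
  - by apply: emeasurable_funM => //; exact/measurable_EFinP.
  (* The moment bound [hmom] is available only where [h] is positive; elsewhere the integrand is
     0. *)
  move=> t _; have := h0 t; rewrite le_eqVlt => /predU1P[<-|ht].
    under eq_integral do rewrite mulr0 mul0r.
    by rewrite integral0 mule0.
  have a0 : 0 <= w^-1 * h t * expR (- (s * n%:R * b)).
    by rewrite !mulr_ge0 ?expR_ge0// invr_ge0 ltW.
  rewrite (eq_integral (fun z => (w^-1 * h t * expR (- (s * n%:R * b)))%:E *
      (expR (s * loss_sum M k' n t z))%:E)%E); last first.
    by move=> z _; rewrite -EFinM expRD mulrA mulrAC.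
  rewrite ge0_integralZl//; last first.
    apply/measurable_EFinP; apply: measurableT_comp => //; apply: measurable_funM => //.
    by apply: measurable_sum_tnth; exact: loss0_measurable_r.
  rewrite integral_expR_loss_sum.
  have hn : ((\int[P_star M]_z (expR (s * loss0 M k' t z))%:E) ^+ n <=
      (expR (n%:R * (s * b1)))%:E)%E.
    apply: expe_le_expR; last exact: hmom.
    by apply: integral_ge0 => z _; rewrite lee_fin expR_ge0.
  apply: le_trans (lee_wpmul2l _ hn) _; first by rewrite lee_fin.
  rewrite -!EFinM lee_fin /c -!mulrA ler_pM2l ?invr_gt0// [leRHS]mulrC.
  rewrite ler_pM2l// -expRD ler_expR.
  by rewrite le_eqVlt; apply/orP; left; apply/eqP; ring.
have intBx x n : x \in xs -> (\int[P_star_pow M n]_z Bx x n z <=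
    (expR (- (sx x * ln kap) - n%:R * (sx x * (hx x - b))))%:E)%E.
  move=> /xsC/(hbr x).2[_ _ vint].
  rewrite (eq_integral (fun z => (expR (sx x * n%:R * b - sx x * ln kap))%:E *
      (expR (\sum_(i < n) sx x * vx x (tnth z i)))%:E)%E); last first.
    by move=> z _; rewrite /Bx /V mulr_sumr -EFinM -expRD addrC.
  rewrite ge0_integralZl ?lee_fin ?expR_ge0//; last first.
    apply/measurable_EFinP; apply: measurableT_comp => //.
    by apply: (measurable_sum_tnth _ _ _ n (fun z => sx x * vx x z)); exact: measurable_funM.
  rewrite (integral_power_expR _ _ _ _ n (fun z => sx x * vx x z)); last exact: measurable_funM.
  have hn : ((\int[P_star M]_z (expR (sx x * vx x z))%:E) ^+ n <=
      (expR (n%:R * - (sx x * hx x)))%:E)%E.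
    apply: expe_le_expR => //.
    by apply: integral_ge0 => z _; rewrite lee_fin expR_ge0.
  apply: le_trans (lee_wpmul2l _ hn) _; first by rewrite lee_fin expR_ge0.
  rewrite -EFinM lee_fin -expRD ler_expR le_eqVlt; apply/orP; left; apply/eqP; ring.
have mSB n : measurable_fun setT (fun z => \sum_(x <- xs) Bx x n z)%E.
  exact: (emeasurable_sum _ (fun x => mBx x n)).
have WE n : (\int[P_star_pow M n]_z W n z <= (expR (0 - n%:R * (s * (b - b1))))%:E +
    \sum_(x <- xs) (expR (- (sx x * ln kap) - n%:R * (sx x * (hx x - b))))%:E)%E.
  rewrite ge0_integralD//; last 3 first.
  - exact: mA.
  - by move=> z _; rewrite sume_ge0.
  - exact: mSB.
  apply: leeD; first exact: intA.
  rewrite ge0_integral_sum//; last by move=> x; exact: mBx.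
  by rewrite big_seq [leRHS]big_seq; apply: lee_sum => x; exact: intBx.
apply: (exp_decay_le _ (fun n => (expR (0 - n%:R * (s * (b - b1))))%:E +
    \sum_(x <- xs) (expR (- (sx x * ln kap) - n%:R * (sx x * (hx x - b))))%:E)%E).
  apply: exp_decayD; first by apply: exp_decay_expR; rewrite mulr_gt0// subr_gt0.
  apply: exp_decay_sum => x xxs; apply: exp_decay_expR.
  rewrite mulr_gt0 ?subr_gt0 ?bhx//.
  by have [[]] := (hbr x).2 (xsC _ xxs).
move=> n _; apply: le_trans (WE n).
pose F := [set z : n.-tuple Z | ((weight M k')%:E * marginal_ratio M k' n z <=
  (weight M k)%:E * marginal_ratio M k n z)%E].
have mF : measurable F.
  rewrite -[X in measurable X]setTI.
  by apply: measurable_lee => //; apply: emeasurable_funM => //;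
    exact: marginal_ratio_measurable.
(* Under infinite evidence the posterior comparison says nothing about the marginals; this null
   event is split off first. *)
rewrite (_ : mkset _ = evidence_infinite M n `|` F); last first.
  by apply/seteqP; split => z /= /posterior_leP; apply.
apply: (@le_trans _ _ (P_star_pow M n (evidence_infinite M n) + P_star_pow M n F)%E).
  by apply: measureU2 => //; exact: evidence_infinite_measurable.
rewrite evidence_infinite_null add0e.
apply: integral_markov => //.
- exact: (emeasurable_funD (mA n) (mSB n)).
- by move=> z; rewrite adde_ge0 ?sume_ge0.
move=> z Fz.
pose K := \sum_(x <- xs) expR (V x n z).
(* Each parameter lies in a ball of the finite cover, so its likelihood ratio is below one term of
   [K]; the prior density has integral 1. *)
have mK : (marginal_ratio M k n z <= K%:E)%E.
  have K0 : 0 <= K by apply: sumr_ge0 => x _; exact: expR_ge0.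
  rewrite -[leRHS]mule1 -(integral_prior_dens0 M k k1) -ge0_integralZl//; last 2 first.
  - by apply/measurable_EFinP; exact: prior_dens0_measurable.
  - by move=> t _; rewrite lee_fin prior_dens0_ge0.
  apply: ge0_le_integral => //.
  - by move=> t _; rewrite lee_fin mulr_ge0 ?expR_ge0 ?prior_dens0_ge0.
  - apply/measurable_EFinP; apply: measurable_funM; last exact: prior_dens0_measurable.
    by apply: measurableT_comp => //; apply: measurable_funN; exact: loss_sum_measurable_l.
  - apply: emeasurable_funM => //.
    by apply/measurable_EFinP; exact: prior_dens0_measurable.
  move=> t _; rewrite -EFinM lee_fin /prior_dens0; case: ifPn => tC; last by rewrite !mulr0.
  have Ct : C (to_row t) by move: tC; rewrite inE.
  apply: ler_wpM2r; first exact: dens_ge0.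
  have [x xxs tx] := hxs _ Ct.
  have [_ hv _] := (hbr x).2 (xsC _ xxs).
  apply: (@le_trans _ _ (expR (V x n z))).
    rewrite ler_expR /loss_sum -sumrN; apply: ler_sum => i _.
    by rewrite /loss0 tC; exact: hv.
  by rewrite /K (big_rem x xxs)/= lerDl sumr_ge0// => y _; exact: expR_ge0.
have sum_ge0 x : x \in xs -> (Bx x n z <= W n z)%E.
  move=> xxs; rewrite /W (big_rem x xxs)/= addeCA leeDl// adde_ge0//.
  by rewrite sume_ge0.
have [/hasP[x xxs Hx]|/hasPn Hn] :=
    boolP (has (fun x => kap * expR (- (n%:R * b)) <= expR (V x n z)) xs).
  apply: le_trans (sum_ge0 _ xxs); rewrite lee_fin -[leLHS]expR0 ler_expR.
  move: Hx; rewrite -{1}(lnK (x := kap)) ?posrE// -expRD ler_expR => Hx.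
  have [[s0x _ _] _ _] := (hbr x).2 (xsC _ xxs).
  have -> : sx x * V x n z + (sx x * n%:R * b - sx x * ln kap) =
      sx x * (V x n z - (ln kap - n%:R * b)) by ring.
  by rewrite mulr_ge0 ?subr_ge0// ltW.
have K_le : weight M k * K <= weight M k' * w * expR (- (n%:R * b)).
  have e0 := expR_gt0 (- (n%:R * b)).
  apply: (@le_trans _ _ (weight M k * (kap * expR (- (n%:R * b)) *+ (size xs).+1))).
    rewrite ler_pM2l// mulrSr; apply: (@le_trans _ _ (kap * expR (- (n%:R * b)) *+ size xs)).
      rewrite -(count_predT xs) -iter_addr_0 -big_const_seq.
      rewrite /K big_seq [leRHS]big_seq; apply: ler_sum => x /Hn.
      by rewrite -ltNge => /ltW.
    by rewrite lerDl mulr_ge0 ?ltW.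
  rewrite -mulr_natr /kap le_eqVlt; apply/orP; left; apply/eqP; field.
  by apply/andP; split; [rewrite nat1r pnatr_eq0|rewrite gt_eqF].
pose X := (\int[leb k']_t (h t * expR (- loss_sum M k' n t z))%:E)%E.
have mhS : measurable_fun setT (fun t => h t * expR (- loss_sum M k' n t z)).
  apply: measurable_funM => //; apply: measurableT_comp => //.
  by apply: measurable_funN; exact: loss_sum_measurable_l.
have X_le : (X <= (w * expR (- (n%:R * b)))%:E)%E.
  apply: (@le_trans _ _ (marginal_ratio M k' n z)).
    apply: ge0_le_integral => //.
    - by move=> t _; rewrite lee_fin mulr_ge0 ?expR_ge0.
    - exact/measurable_EFinP.
    - apply/measurable_EFinP; apply: measurable_funM; last exact: prior_dens0_measurable.
      by apply: measurableT_comp => //; apply: measurable_funN; exact: loss_sum_measurable_l.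
    - by move=> t _; rewrite lee_fin mulrC ler_wpM2l ?expR_ge0.
  rewrite -(@lee_pmul2l _ (weight M k')%:E)// ?lte_fin//.
  apply: le_trans Fz _; apply: (@le_trans _ _ ((weight M k)%:E * K%:E)%E).
    by rewrite lee_pmul2l// lte_fin.
  by rewrite -!EFinM lee_fin mulrA.
apply: (@le_trans _ _ (A n z)); last by rewrite /W leeDl// sume_ge0.
(* [expR_tangent_le] is integrated against [h / w]. The subtracted term of the tangent is moved to
   the right, where its integral is at most [s] by [X_le]; cancelling [s] gives [1 <= A n z]. *)
have : ((1 + s)%:E <= A n z + s%:E)%E.
  have E1 : (\int[leb k']_t ((w^-1 * (1 + s))%:E * (h t)%:E) = (1 + s)%:E)%E.
    rewrite ge0_integralZl//.
    - by rewrite wE -EFinM mulrAC mulVf ?mul1r// gt_eqF.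
    - exact/measurable_EFinP.
    - by move=> t _; rewrite lee_fin.
    - by rewrite lee_fin mulr_ge0 ?invr_ge0 ?addr_ge0 ?ltW.
  have E2 : (\int[leb k']_t ((w^-1 * s * expR (n%:R * b))%:E *
      (h t * expR (- loss_sum M k' n t z))%:E) <= s%:E)%E.
    have q0 : 0 <= w^-1 * s * expR (n%:R * b).
      by rewrite !mulr_ge0 ?expR_ge0 ?invr_ge0 ?ltW.
    rewrite ge0_integralZl//; last 2 first.
    - exact/measurable_EFinP.
    - by move=> t _; rewrite lee_fin mulr_ge0 ?expR_ge0.
    apply: le_trans (lee_wpmul2l _ X_le) _; first by rewrite lee_fin.
    rewrite -EFinM lee_fin expRN le_eqVlt; apply/orP; left; apply/eqP; field.
    by rewrite !gt_eqF ?expR_gt0.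
  rewrite -E1; apply: (@le_trans _ _ (A n z + \int[leb k']_t
      ((w^-1 * s * expR (n%:R * b))%:E * (h t * expR (- loss_sum M k' n t z))%:E))%E);
    last exact: leeD2l.
  have mAz : measurable_fun setT (fun t =>
      (w^-1 * h t * expR (s * loss_sum M k' n t z - s * n%:R * b))%:E).
    apply/measurable_EFinP; apply: measurable_funM; first exact: measurable_funM.
    apply: measurableT_comp => //; apply: measurable_funB => //.
    by apply: measurable_funM => //; exact: loss_sum_measurable_l.
  rewrite -ge0_integralD//; last 3 first.
  - by move=> t _; exact: (Aj0 n (t, z)).
  - move=> t _; rewrite -EFinM lee_fin.
    by rewrite !mulr_ge0 ?expR_ge0 ?invr_ge0 ?(ltW w0) ?(ltW s0).
  - by apply: emeasurable_funM => //; exact/measurable_EFinP.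
  apply: ge0_le_integral => //.
  - by move=> t _; rewrite -EFinM lee_fin !mulr_ge0 ?invr_ge0 ?addr_ge0 ?(ltW w0) ?(ltW s0).
  - by apply: emeasurable_funM => //; exact/measurable_EFinP.
  - apply: emeasurable_funD => //.
    by apply: emeasurable_funM => //; exact/measurable_EFinP.
  move=> t _; rewrite -!EFinM -EFinD lee_fin.
  have := expR_tangent_le s (- loss_sum M k' n t z + n%:R * b) (ltW s0).
  have -> : - (s * (- loss_sum M k' n t z + n%:R * b)) =
      s * loss_sum M k' n t z - s * n%:R * b by ring.
  rewrite expRD.
  have wh0 : 0 <= w^-1 * h t by rewrite mulr_ge0 ?invr_ge0 ?(ltW w0) ?(ltW s0).
  move=> /(ler_wpM2l wh0); lra.
by case: (A n z) => [r| |]//; rewrite ?leey// -EFinD !lee_fin lerD2r.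
Qed.

End underestimation.

(** * Union bounds over the orders below [k_star] *)

Lemma le_measure_sum_seq d (T : measurableType d) (R : realType)
    (m : {measure set T -> \bar R}) (I : eqType) (s : seq I) (E : I -> set T)
    (S : set T) : measurable S -> (forall i, i \in s -> measurable (E i)) ->
  (forall x, S x -> exists2 i, i \in s & E i x) ->
  (m S <= \sum_(i <- s) m (E i))%E.
Proof.
elim: s S => [|i s IH] S mS mE SE.
  rewrite big_nil (_ : S = set0) ?measure0//.
  by apply/seteqP; split => // x /SE[].
rewrite big_cons.
have mEi : measurable (E i) by apply: mE; rewrite mem_head.
apply: (@le_trans _ _ (m (E i) + m (S `\` E i))%E).
  apply: (@le_trans _ _ (m (E i `|` (S `\` E i)))).
    apply: le_measure; rewrite ?inE//; first by apply: measurableU => //; exact: measurableD.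
    by move=> x Sx; have [|] := pselect (E i x); [left|right].
  by apply: measureU2 => //; exact: measurableD.
apply: leeD2l; apply: IH; first exact: measurableD.
- by move=> j js; apply: mE; rewrite inE js orbT.
- move=> x [/SE[j]]; rewrite inE => /predU1P[->//|js Ejx _].
  by exists j.
Qed.

Theorem theorem1 (R : realType) (d : measure_display) (Z : measurableType d)
    (mu : {measure set Z -> \bar R}) (M : bayes_model mu)
    (hA1 : A1 M) (hA2 : A2 M)
    (hweight : forall k, (1 <= k <= k_star M)%N -> 0 < weight M k)
    (hprior : forall k (delta : R), (1 <= k <= k_star M)%N -> 0 < delta ->
      (0 < prior_prob M k (Sset M k delta))%E) :
  (forall kG : forall n, n.-tuple Z -> nat,
     (forall n, (1 <= n)%N -> is_kG M n (kG n)) ->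
     exists c1' c2' : R, [/\ 0 < c1', 0 < c2' &
       forall n, (1 <= n)%N ->
         (P_star_pow M n [set z | (kG n z < k_star M)%N]
            <= (c1' * expR (- (n%:R * c2')))%:E)%E])
  /\
  ((forall k, (1 <= k < k_star M)%N -> (H_star M k.+1 < H_star M k)%E) ->
     exists c1 c2 : R, [/\ 0 < c1, 0 < c2 &
       forall n, (1 <= n)%N ->
         (P_star_pow M n [set z | (kL M n z < (k_star M)%:R%:E)%E]
            <= (c1 * expR (- (n%:R * c2)))%:E)%E]).

Proof.
have decay k k' : (1 <= k <= k_star M)%N -> (1 <= k' <= k_star M)%N ->
    (forall x, coord_set M k x -> (H_star M k' < KL M (par M k x))%E) ->
    exp_decay (fun n => P_star_pow M n
      [set z | (posterior M k' n z <= posterior M k n z)%E]).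
  move=> kk kk' hKL; have /andP[k1 _] := kk; have /andP[k'1 _] := kk'.
  apply: posterior_le_decay => //; [exact: hweight|exact: hweight|].
  by move=> dl; exact: hprior.
have ks1 : (1 <= k_star M)%N := Defs.order_gt0 _ M.
pose ks := iota 1 (k_star M).-1.
have ksP k : (k \in ks) = (1 <= k < k_star M)%N.
  by rewrite mem_iota add1n prednK.
split => [kG hkG|hH].
(* A selected order below [k_star M] maximizes the posterior, so it beats [k_star M], where [H_star]
   is at most 0 while divergences at lower orders are positive. *)
- pose E k n := [set z | (posterior M (k_star M) n z <= posterior M k n z)%E].
  apply: (exp_decay_le _ (fun n => \sum_(k <- ks) P_star_pow M n (E k n))%E).
    apply: exp_decay_sum => k; rewrite ksP => kk.
    apply: decay; [lia|lia|] => x Cx.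
    by apply: le_lt_trans (H_star_k_star M) _; exact: KL_gt0.
  move=> n n1; have [mkG hk] := hkG n n1.
  apply: le_measure_sum_seq.
  + by rewrite -[X in measurable X]setTI; exact: (mkG measurableT [set j | (j < k_star M)%N]).
  + move=> k; rewrite ksP => /andP[k1 _]; exact: posterior_le_measurable.
  + move=> z /= kz; have [kG1 kGmax] := hk z.
    by exists (kG n z); [rewrite ksP kG1|exact: kGmax].
(* Here each order is compared with its successor: the gap between consecutive [H_star] puts every
   divergence at order [k] above [H_star M k.+1]. *)
- pose E k n := [set z | (posterior M k.+1 n z <= posterior M k n z)%E].
  apply: (exp_decay_le _ (fun n => \sum_(k <- ks) P_star_pow M n (E k n))%E).
    apply: exp_decay_sum => k; rewrite ksP => kk.
    apply: decay; [lia|lia|] => x Cx.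
    apply: lt_le_trans (hH _ kk) _.
    by apply: ereal_inf_lbound; exists (par M k x) => //; exists x.
  move=> n n1.
  (* An infimum below [k_star M] has a member below it, that is, an order below [k_star M] at which
     the posterior does not increase. *)
  have SE z : (kL M n z < (k_star M)%:R%:E)%E ->
      exists2 k, k \in ks & E k n z.
    move=> /ereal_inf_lt[_ [k [k1 Ek] <-]]; rewrite lte_fin ltr_nat => kk.
    by exists k; rewrite ?ksP ?k1.
  apply: le_measure_sum_seq => //.
  (* The event coincides with the finite union of the comparisons, whence its measurability. *)
  + rewrite (_ : mkset _ = \bigcup_(k in [set k | k \in ks]) E k n).
      apply: bigcup_measurable => k /=; rewrite ksP => /andP[k1 _].
      exact: posterior_le_measurable.
    apply/seteqP; split => z /=; first exact: SE.
    move=> [k /= kks Ek]; move: kks; rewrite ksP => /andP[k1 kk].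
    apply: (@le_lt_trans _ _ k%:R%:E); last by rewrite lte_fin ltr_nat.
    by apply: ereal_inf_lbound; exists k.
  + move=> k; rewrite ksP => /andP[k1 _]; exact: posterior_le_measurable.
Qed.
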